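(* Let $(P_n)_{n\ge 1}$ be a sequence of irreducible stochastic matrices, $P_n$ acting on a finite state space $\mathscr{X}_n$ with $N_n=|\mathscr{X}_n|\ge 3$, each with symmetric support and non-negative curvature (in the Ollivier-Ricci sense or in the Bakry-Émery sense, indifferently). Write $\mathrm{t}_{\mathrm{mix}}^{(n)}(\cdot)$, $\mathrm{t}_{\mathrm{rel}}^{(n)}$, $\Delta_n$ for the mixing times, relaxation time and sparsity parameter of $P_n$. Suppose that $$\mathrm{t}_{\mathrm{rel}}^{(n)}\cdot\frac{(\log\Delta_n)^{3/2}}{(\log N_n)^{1/2}}\xrightarrow[n\to\infty]{}0 .$$ Then the sequence exhibits cutoff, i.e. for every fixed $\varepsilon\in(0,1)$, $\mathrm{t}_{\mathrm{mix}}^{(n)}(1-\varepsilon)/\mathrm{t}_{\mathrm{mix}}^{(n)}(\varepsilon)\to 1$ as $n\to\infty$.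
   Context: Let $P$ be an irreducible stochastic matrix on a finite set $\mathscr{X}$, with unique invariant law $\pi=\pi P$. Heat kernel: $\mathscr{P}_t(x,y)=e^{-t}\sum_{k\ge 0}\frac{P^k(x,y)t^k}{k!}$ for $t\ge0$, acting on functions by $(\mathscr{P}_tf)(x)=\sum_y\mathscr{P}_t(x,y)f(y)$. Mixing time: $\mathrm{t}_{\mathrm{mix}}(\varepsilon)=\min\{t\ge 0:\max_{x}\|\mathscr{P}_t(x,\cdot)-\pi\|_{\mathrm{TV}}\le\varepsilon\}$, $\varepsilon\in(0,1)$, with $\|\mu-\pi\|_{\mathrm{TV}}=\max_{A\subseteq\mathscr{X}}|\mu(A)-\pi(A)|$. Generator: $(\mathscr{L}f)(x)=\sum_yP(x,y)(f(y)-f(x))$. Carré du champ: $\Gamma(f,g)(x)=\frac12\sum_yP(x,y)(f(y)-f(x))(g(y)-g(x))$. Relaxation time: $\mathrm{t}_{\mathrm{rel}}$ is the optimal constant in $\mathrm{Var}_\pi(f)\le \mathrm{t}_{\mathrm{rel}}\,\mathbf{E}_\pi[\Gamma(f,f)]$ for all $f:\mathscr{X}\to\mathbb{R}$ (equivalently the inverse spectral gap of $\frac{P+P^\star}{2}$, with $P^\star(x,y)=\pi(y)P(y,x)/\pi(x)$). $P$ is not assumed reversible. Symmetric support: $P(x,y)>0\iff P(y,x)>0$. In that case $\mathrm{dist}(x,y)=\min\{k\in\mathbb{Z}_+:P^k(x,y)>0\}$ is a metric on $\mathscr{X}$, and $x\sim y$ means $\mathrm{dist}(x,y)=1$. Sparsity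 parameter: $\Delta=\max\{1/P(x,y): x\sim y\}$. Ollivier-Ricci curvature: the largest $\kappa$ such that $\mathcal{W}_1(\mathscr{P}_t(x,\cdot),\mathscr{P}_t(y,\cdot))\le e^{-\kappa t}\,\mathrm{dist}(x,y)$ for all $t\ge0$ and $x,y\in\mathscr{X}$, where $\mathcal{W}_1$ is the $L^1$-Wasserstein distance associated with $\mathrm{dist}$. Bakry-Émery curvature: the largest $\kappa$ such that $\frac12\mathscr{L}\Gamma(f,f)\ge\Gamma(f,\mathscr{L}f)+\kappa\Gamma(f,f)$ pointwise for all $f:\mathscr{X}\to\mathbb{R}$. Non-negative curvature means that at least one of these two curvatures is $\ge0$. *)

(* Defs.v *)
From HB Require Import structures.
From mathcomp Require Import all_boot all_order all_algebra.
From mathcomp Require Import all_classical all_reals all_analysis.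
Import Order.TTheory GRing.Theory Num.Theory.
Import numFieldNormedType.Exports.

Set Implicit Arguments.
Unset Strict Implicit.
Unset Printing Implicit Defensive.

Local Open Scope classical_set_scope.
Local Open Scope ring_scope.

Section MarkovChain.
Variables (R : realType) (T : finType).
Implicit Types (P : T -> T -> R) (mu nu pi : T -> R) (f g : T -> R) (x y : T).

Definition probability_vector mu : Prop :=
  (forall x, 0 <= mu x) /\ \sum_x mu x = 1.

Definition stochastic P : Prop := forall x, probability_vector (P x).

Fixpoint kpow P (k : nat) x y : R :=
  if k is k'.+1 then \sum_z P x z * kpow P k' z y else (x == y)%:R.

Definition irreducible P : Prop := forall x y, exists k, 0 < kpow P k x y.

(* Unique when P is irreducible. *)
Definition invariant_law P pi : Prop :=
  probability_vector pi /\ forall y, pi y = \sum_x pi x * P x y.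

Definition heat_kernel P (t : R) x y : R :=
  expR (- t) * limn (series (fun k : nat => kpow P k x y * t ^+ k / k`!%:R)).

Definition tv_dist mu nu : R :=
  \big[Num.max/0]_(A : {set T}) `|\sum_(x in A) mu x - \sum_(x in A) nu x|.

(* For P irreducible with invariant law pi and 0 < eps, the set is nonempty and
   closed, so that its infimum is a minimum. *)
Definition tmix P pi (eps : R) : R :=
  inf [set t : R | 0 <= t /\
    \big[Num.max/0]_x tv_dist (heat_kernel P t x) pi <= eps].

Definition generator P f x : R := \sum_y P x y * (f y - f x).

Definition carre_du_champ P f g x : R :=
  2^-1 * \sum_y P x y * (f y - f x) * (g y - g x).

Definition mean_under pi f : R := \sum_x pi x * f x.

Definition var_under pi f : R :=
  mean_under pi (fun x => (f x - mean_under pi f) ^+ 2).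

(* For P irreducible with invariant law pi and 1 < #|T|, the set of admissible
   constants is nonempty, closed and bounded below. *)
Definition trel P pi : R :=
  inf [set c : R | forall f,
    var_under pi f <= c * mean_under pi (carre_du_champ P f f)].

Definition symmetric_support P : Prop := forall x y, 0 < P x y <-> 0 < P y x.

(* The value 0 for disconnected x and y is never used when P is irreducible. *)
Definition dist P x y : nat :=
  if pselect (exists k, 0 < kpow P k x y) is left ex then ex_minn ex else 0%N.

Definition neighbor P x y : bool := dist P x y == 1%N.

(* The default value 0 is irrelevant as soon as some pair of neighbors exists. *)
Definition sparsity P : R :=
  \big[Num.max/0]_(xy : T * T | neighbor P xy.1 xy.2) (P xy.1 xy.2)^-1.

Definition coupling mu nu (q : T -> T -> R) : Prop :=
  [/\ forall x y, 0 <= q x y,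
      forall x, \sum_y q x y = mu x &
      forall y, \sum_x q x y = nu y].

Definition wasserstein P mu nu : R :=
  inf [set \sum_x \sum_y q x y * (dist P x y)%:R | q in coupling mu nu].

(* Curvatures are taken in the extended reals, so that no junk value arises from
   an empty or unbounded set. *)
Definition ollivier_ricci_curvature P : \bar R :=
  ereal_sup [set kappa%:E | kappa in [set kappa : R |
    forall (t : R) x y, 0 <= t ->
      wasserstein P (heat_kernel P t x) (heat_kernel P t y)
        <= expR (- kappa * t) * (dist P x y)%:R]].

Definition bakry_emery_curvature P : \bar R :=
  ereal_sup [set kappa%:E | kappa in [set kappa : R |
    forall f x,
      carre_du_champ P f (generator P f) x + kappa * carre_du_champ P f f x
        <= 2^-1 * generator P (carre_du_champ P f f) x]].

Definition nonneg_curvature P : Prop :=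
  (0 <= ollivier_ricci_curvature P)%E \/ (0 <= bakry_emery_curvature P)%E.

End MarkovChain.

(* Main.v *)
Require Import Defs.
From HB Require Import structures.
From mathcomp Require Import all_boot all_order all_algebra.
From mathcomp Require Import all_classical all_reals all_analysis.
From mathcomp Require Import ring lra.
Import Order.TTheory GRing.Theory Num.Theory.
Import numFieldNormedType.Exports.

Set Implicit Arguments.
Unset Strict Implicit.
Unset Printing Implicit Defensive.

Local Open Scope classical_set_scope.
Local Open Scope ring_scope.

(** Start from o and let t be a time at which the distance to pi is
    at most 1 - e. The density f of the law at time t has log-variance at most
    t L^2, where L is the Lipschitz constant of log f: this is the local Poincare
    inequality given by non-negative curvature. By Chebyshev, f is then at most
    exp (2r + O(1)) off a set of mass e / 4, with r of order L sqrt t, and the L^2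
    contraction at rate 1 / trel brings the distance below e within an additional
    time trel * O(1 + r). A Harnack inequality gives L = O(log Delta) as soon as t
    is at least a constant times the diameter D. This last condition is automatic:
    under pi, the distance to one of two antipodal points has mean at least D / 2
    and is concentrated (Poincare inequality), whereas the chain moves at speed at most 1. Since
    log N <= D (1 + log Delta), the assumption makes trel (1 + L sqrt t)
    negligible with respect to t. *)

(** * Calculus *)

Section Calculus.
Variable R : realType.
Implicit Types (c : nat -> R) (t : R).

Lemma is_derive_big (I : finType) (f : I -> R -> R) (df : I -> R) t :
  (forall i, is_derive t 1 (f i) (df i)) ->
  is_derive t 1 (fun s => \sum_i f i s) (\sum_i df i).
Proof.
move=> fdf.
have -> : (fun s => \sum_i f i s) = \sum_i f i by rewrite fct_sumE.
elim/big_ind2 : _ => // [|? ? ? ? ? ?]; first exact: is_derive_cst.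
exact: is_deriveD.
Qed.

Lemma is_derive_sqr (f : R -> R) (df t : R) : is_derive t 1 f df ->
  is_derive t 1 (fun s => f s ^+ 2) (2 * f t * df).
Proof.
move=> fdf; have /is_derive_eq := is_deriveM fdf fdf; apply.
by rewrite /GRing.scale /=; ring.
Qed.

Lemma derive_le_increment (f df : R -> R) (C a : R) : 0 <= a ->
  (forall s, 0 <= s <= a -> is_derive s 1 f (df s)) ->
  (forall s, 0 <= s <= a -> df s <= C) ->
  f a <= f 0 + C * a.
Proof.
move=> a0 fdf dfC; rewrite -lerBlDl.
have [x|x|s] := @MVT_segment R f df 0 a a0.
- by rewrite in_itv /= => /andP[x0 xa]; apply: fdf; rewrite !ltW.
- apply: (continuous_in_subspaceT (A := `[0, a]%classic)) => {}x.
  rewrite inE /= in_itv /= => /fdf xfdf.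
  by apply: differentiable_continuous; apply/derivable1_diffP; apply: ex_derive.
- rewrite in_itv /= subr0 => s0a ->.
  by rewrite ler_wpM2r// dfC.
Qed.

(** Exponential generating function of [c]. For [c k = kpow P k x y] it is [expR t] times the heat
    kernel, so estimates on numbers of jumps become estimates on the kernel. *)
Definition egf c t : R := limn (series (fun k => c k * t ^+ k / k`!%:R)).

Lemma egf_cvg c t : (forall k, `|c k| <= 1) ->
  cvgn (series (fun k => c k * t ^+ k / k`!%:R)).
Proof.
move=> c1; apply: normed_cvg.
apply: series_le_cvg (is_cvg_series_exp_coeff `|t|) => [n|n|n].
- exact: normr_ge0.
- exact: exp_coeff_ge0.
- rewrite /exp_coeff /= !normrM normrX -mulrA (ger0_norm (x := _^-1)) ?invr_ge0 //.
  by rewrite ler_piMl// mulr_ge0 ?exprn_ge0// invr_ge0.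
Qed.

Lemma egf_pseries c t : series (fun k => c k * t ^+ k / k`!%:R) =
  pseries (fun k => c k / k`!%:R) t.
Proof. by congr series; apply/funext => k; rewrite mulrAC. Qed.

Lemma egf_diffs c :
  pseries_diffs (fun k => c k / k`!%:R) = (fun k => c k.+1 / k`!%:R).
Proof.
apply/funext => k; rewrite /pseries_diffs factS natrM invfM.
by rewrite mulrCA mulVKf // pnatr_eq0.
Qed.

Lemma is_derive_egf c t : (forall k, `|c k| <= 1) ->
  is_derive t 1 (egf c) (egf (c \o succn) t).
Proof.
move=> c1; rewrite /egf.
rewrite (_ : (fun _ => _) = fun s => limn (pseries (fun k => c k / k`!%:R) s));
  last by apply/funext => s; rewrite egf_pseries.
rewrite egf_pseries /= -egf_diffs.
apply: (@pseries_snd_diffs _ _ (`|t| + 1)).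
- by rewrite -egf_pseries; exact: egf_cvg.
- by rewrite egf_diffs -(@egf_pseries (fun k => c k.+1)); exact: egf_cvg.
- rewrite egf_diffs (@egf_diffs (fun k => c k.+1)).
  by rewrite -(@egf_pseries (fun k => c k.+2)); exact: egf_cvg.
- by rewrite [ltRHS]ger0_norm ?ltrDl// addr_ge0.
Qed.

Lemma egf0 c : egf c 0 = c 0%N.
Proof.
rewrite /egf; apply: lim_near_cst => //.
near=> m; rewrite -[m]prednK; last by near: m; exists 1%N.
rewrite /series /= big_nat_recl// big1 ?addr0 ?expr0 ?fact0 ?mulr1 ?divr1//.
by move=> i _; rewrite exprS mul0r mulr0 mul0r.
Unshelve. all: by end_near. Qed.

Lemma egf1 t : egf (fun=> 1) t = expR t.
Proof.
by rewrite /egf /expR; congr (limn (series _)); apply/funext => k;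
   rewrite mul1r.
Qed.

Lemma egf_sum (I : finType) (a : I -> R) (c : I -> nat -> R) t :
  (forall i k, `|c i k| <= 1) ->
  egf (fun k => \sum_i a i * c i k) t = \sum_i a i * egf (c i) t.
Proof.
move=> c1; apply/cvg_lim => //.
rewrite (_ : series _ = fun n => \sum_i a i *
  series (fun k => c i k * t ^+ k / k`!%:R) n); last first.
  apply/funext => n; rewrite /series /=.
  under [RHS]eq_bigr do rewrite mulr_sumr.
  rewrite [RHS]exchange_big; apply: eq_bigr => k _.
  by rewrite !mulr_suml; apply: eq_bigr => i _; rewrite !mulrA.
apply: cvg_big => [|i _]; first exact: add_continuous.
by apply: cvgMl_tmp; exact: egf_cvg.
Qed.

Lemma egf_partial_le c t n : (forall k, 0 <= c k <= 1) -> 0 <= t ->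
  \sum_(0 <= k < n) c k * t ^+ k / k`!%:R <= egf c t.
Proof.
move=> c01 t0.
apply: (@nondecreasing_cvgn_le _ (series (fun k => c k * t ^+ k / k`!%:R))).
  apply/nondecreasing_seqP => k; rewrite /series /= big_nat_recr//= lerDl.
  by have /andP[? _] := c01 k; rewrite !mulr_ge0// ?exprn_ge0// invr_ge0.
by apply: egf_cvg => k; have /andP[c0 c1] := c01 k; rewrite ger0_norm.
Qed.

Lemma egf_term_le c t n : (forall k, 0 <= c k <= 1) -> 0 <= t ->
  c n * t ^+ n / n`!%:R <= egf c t.
Proof.
move=> c01 t0; apply: le_trans (egf_partial_le n.+1 c01 t0).
rewrite big_nat_recr//= lerDr sumr_ge0// => k _.
by have /andP[? _] := c01 k; rewrite !mulr_ge0// ?exprn_ge0// invr_ge0.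
Qed.

(** Compares term [k] of one series with term [k.+1] of another, up to an exponential tail. The term
    [d 0] lost in the shift is nonnegative. The shift will be one extra jump of the chain. *)
Lemma egf_le_shift c d t (K C s : R) : (forall k, `|c k| <= 1) ->
  (forall k, 0 <= d k <= 1) -> 0 <= t -> 0 <= K -> 0 <= C -> 0 <= s ->
  (forall k, c k * t ^+ k / k`!%:R <=
     K * (d k.+1 * t ^+ k.+1 / k.+1`!%:R) + C * (s ^+ k / k`!%:R)) ->
  egf c t <= K * egf d t + C * expR s.
Proof.
move=> c1 d01 t0 K0 C0 s0 le_cd; apply: limr_le; first exact: egf_cvg.
near=> n; apply: (le_trans (ler_sum _ (fun k _ => le_cd k))).
rewrite big_split /= -!mulr_sumr lerD// ler_wpM2l//.
  apply: le_trans (egf_partial_le n.+1 d01 t0).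
  rewrite big_nat_recl//= lerDr.
  by have /andP[? _] := d01 0%N; rewrite !mulr_ge0// ?exprn_ge0// invr_ge0.
rewrite -egf1; have one01 (k : nat) : 0 <= (1 : R) <= 1 by rewrite ler01 lexx.
apply: le_trans (egf_partial_le n one01 s0).
by apply: ler_sum => k _; rewrite mul1r.
Unshelve. all: by end_near. Qed.

End Calculus.

(** * The heat semigroup *)

Section Chain.
Variables (R : realType) (T : finType) (P : T -> T -> R).
Hypothesis stochP : stochastic P.
Implicit Types (f g h : T -> R) (x y z : T) (t s : R) (k : nat).

Lemma transition_ge0 x y : 0 <= P x y.
Proof. by have [] := stochP x. Qed.

Lemma transition_sum x : \sum_y P x y = 1.
Proof. by have [] := stochP x. Qed.

Lemma kpow_ge0 k x y : 0 <= kpow P k x y.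
Proof.
elim: k x => [|k IHk] x /=; first exact: ler0n.
by apply: sumr_ge0 => z _; rewrite mulr_ge0// transition_ge0.
Qed.

Lemma sum_indicator f x : \sum_y (x == y)%:R * f y = f x.
Proof.
rewrite (bigD1 x)//= eqxx mul1r big1 ?addr0// => y /negbTE.
by rewrite eq_sym => ->; rewrite mul0r.
Qed.

Lemma kpow_sum k x : \sum_y kpow P k x y = 1.
Proof.
elim: k x => [|k IHk] x /=.
  by under eq_bigr do rewrite -[_%:R]mulr1; rewrite (sum_indicator (fun=> 1)).
rewrite exchange_big /=; under eq_bigr do rewrite -mulr_sumr IHk mulr1.
exact: transition_sum.
Qed.

Lemma kpow_le1 k x y : kpow P k x y <= 1.
Proof.
rewrite -(kpow_sum k x) (bigD1 y)//= lerDl.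
by apply: sumr_ge0 => z _; exact: kpow_ge0.
Qed.

Lemma kpow_normr k x y : `|kpow P k x y| <= 1.
Proof. by rewrite ger0_norm ?kpow_ge0// kpow_le1. Qed.

Lemma kpowD j k x y :
  kpow P (j + k) x y = \sum_z kpow P j x z * kpow P k z y.
Proof.
elim: j x => [|j IHj] x /=; first by rewrite sum_indicator.
under [RHS]eq_bigr do rewrite mulr_suml.
rewrite [RHS]exchange_big /=; apply: eq_bigr => z _.
by rewrite IHj mulr_sumr; apply: eq_bigr => w _; rewrite mulrA.
Qed.

Lemma kpow1 x y : kpow P 1 x y = P x y.
Proof.
rewrite /= (bigD1 y)//= eqxx mulr1 big1 ?addr0// => z /negbTE ->.
by rewrite mulr0.
Qed.

Lemma kpowSr k x y : kpow P k.+1 x y = \sum_z kpow P k x z * P z y.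
Proof.
by rewrite -addn1 kpowD; apply: eq_bigr => z _; rewrite kpow1.
Qed.

Lemma kpowD_ge j k x y z : kpow P j x z * kpow P k z y <= kpow P (j + k) x y.
Proof.
rewrite kpowD (bigD1 z)//= lerDl.
by apply: sumr_ge0 => w _; rewrite mulr_ge0 ?kpow_ge0.
Qed.

Lemma kpow_gt0_trans j k x y z : 0 < kpow P j x z -> 0 < kpow P k z y ->
  0 < kpow P (j + k) x y.
Proof. by move=> ? ?; apply: lt_le_trans (kpowD_ge _ _ _ _ z); exact: mulr_gt0. Qed.

Lemma kpowS_gt0 k x y : 0 < kpow P k.+1 x y ->
  exists2 z, 0 < kpow P k x z & 0 < P z y.
Proof.
rewrite kpowSr => sum_gt0.
have [z kz|no] := pickP (fun z => 0 < kpow P k x z * P z y).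
  exists z; rewrite lt0r ?kpow_ge0 ?transition_ge0 andbT;
    by apply: contraTneq kz => ->; rewrite ?(mul0r, mulr0) ltxx.
by move: sum_gt0; rewrite ltNge sumr_le0// => z _; rewrite leNgt no.
Qed.

Lemma heat_kernelE t x y :
  heat_kernel P t x y = expR (- t) * egf (fun k => kpow P k x y) t.
Proof. by []. Qed.

Lemma heat_kernel_ge t x y k : 0 <= t ->
  expR (- t) * (kpow P k x y * t ^+ k / k`!%:R) <= heat_kernel P t x y.
Proof.
move=> t0; rewrite heat_kernelE ler_wpM2l ?expR_ge0//.
apply: (egf_term_le (c := fun k => kpow P k x y)) => // j.
by rewrite kpow_ge0 kpow_le1.
Qed.

Lemma heat_kernel_ge0 t x y : 0 <= t -> 0 <= heat_kernel P t x y.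
Proof.
move=> t0; apply: le_trans (heat_kernel_ge x y 0 t0).
by rewrite mulr_ge0 ?expR_ge0// !mulr_ge0 ?exprn_ge0// ?kpow_ge0// invr_ge0.
Qed.

Lemma heat_kernel_sum t x : \sum_y heat_kernel P t x y = 1.
Proof.
rewrite -mulr_sumr; under eq_bigr do rewrite -[limn _]mul1r.
rewrite -(@egf_sum _ _ (fun=> 1) (fun y k => kpow P k x y)); last first.
  by move=> *; exact: kpow_normr.
rewrite (_ : (fun _ => _) = fun=> 1); last first.
  by apply/funext => k; under eq_bigr do rewrite mul1r; rewrite kpow_sum.
by rewrite egf1 mulrC expRxMexpNx_1.
Qed.

Lemma heat_kernel_le1 t x y : 0 <= t -> heat_kernel P t x y <= 1.
Proof.
move=> t0; rewrite -(heat_kernel_sum t x) (bigD1 y)//= lerDl.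
by apply: sumr_ge0 => z _; exact: heat_kernel_ge0.
Qed.

Lemma heat_kernel0 x y : heat_kernel P 0 x y = (x == y)%:R.
Proof. by rewrite heat_kernelE oppr0 expR0 mul1r egf0. Qed.

(** Common source of the forward and backward Kolmogorov equations, obtained by splitting the last
    or the first step off [kpow P k.+1]. *)
Lemma is_derive_heat_kernel_gen t x y :
  is_derive t 1 (fun s => heat_kernel P s x y)
    (expR (- t) * egf (fun k => kpow P k.+1 x y) t - heat_kernel P t x y).
Proof.
have E : is_derive t 1 (egf (fun k => kpow P k x y))
    (egf (fun k => kpow P k.+1 x y) t).
  by apply: (@is_derive_egf _ (fun k => kpow P k x y)) => k; exact: kpow_normr.
have N : is_derive t 1 (fun s => expR (- s)) (- expR (- t)).
  have := @is_derive1_comp R expR -%R t (expR (- t)) (- 1) _ _.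
  by rewrite mulrN1; apply.
have := @is_deriveM R _ (fun s => expR (- s)) (egf (fun k => kpow P k x y)) t
  1 _ _ N E.
move/is_derive_eq; apply.
by rewrite /GRing.scale /= heat_kernelE; ring.
Qed.

Lemma is_derive_heat_kernel_r t x y :
  is_derive t 1 (fun s => heat_kernel P s x y)
    (\sum_z heat_kernel P t x z * P z y - heat_kernel P t x y).
Proof.
have /is_derive_eq := is_derive_heat_kernel_gen t x y; apply; congr (_ - _).
rewrite (_ : (fun k => _) = fun k => \sum_z P z y * kpow P k x z); last first.
  apply/funext => k; rewrite kpowSr.
  by apply: eq_bigr => z _; rewrite mulrC.
rewrite (egf_sum (fun z => P z y) (c := fun z k => kpow P k x z)); last first.
  by move=> *; exact: kpow_normr.
by rewrite mulr_sumr; apply: eq_bigr => z _; rewrite heat_kernelE; ring.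
Qed.

Lemma is_derive_heat_kernel_l t x y :
  is_derive t 1 (fun s => heat_kernel P s x y)
    (\sum_z P x z * heat_kernel P t z y - heat_kernel P t x y).
Proof.
have /is_derive_eq := is_derive_heat_kernel_gen t x y; apply; congr (_ - _).
rewrite (egf_sum (fun z => P x z) (c := fun z k => kpow P k z y)); last first.
  by move=> *; exact: kpow_normr.
by rewrite mulr_sumr; apply: eq_bigr => z _; rewrite heat_kernelE; ring.
Qed.

(** * Action of the semigroup on functions and interpolation *)

Definition heat_op t h x : R := \sum_y heat_kernel P t x y * h y.

Lemma generatorE f x : generator P f x = \sum_y P x y * f y - f x.
Proof.
rewrite /generator; under eq_bigr do rewrite mulrBr.
by rewrite sumrB -mulr_suml transition_sum mul1r.
Qed.

Lemma heat_op0 h x : heat_op 0 h x = h x.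
Proof.
rewrite /heat_op; under eq_bigr do rewrite heat_kernel0.
exact: sum_indicator.
Qed.

Lemma heat_op_le t f g x : 0 <= t -> (forall y, f y <= g y) ->
  heat_op t f x <= heat_op t g x.
Proof.
by move=> t0 fg; apply: ler_sum => y _; rewrite ler_wpM2l ?heat_kernel_ge0.
Qed.

Lemma heat_op_cst t (c : R) x : heat_op t (fun=> c) x = c.
Proof. by rewrite /heat_op -mulr_suml heat_kernel_sum mul1r. Qed.

Lemma heat_opN t f x : heat_op t (fun y => - f y) x = - heat_op t f x.
Proof. by rewrite -sumrN; apply: eq_bigr => y _; rewrite mulrN. Qed.

Lemma generatorN f x : generator P (fun y => - f y) x = - generator P f x.
Proof. by rewrite /generator -sumrN; apply: eq_bigr => y _; ring. Qed.

Lemma is_derive_heat_op t h x :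
  is_derive t 1 (fun s => heat_op s h x) (generator P (heat_op t h) x).
Proof.
have /is_derive_eq := is_derive_big (fun y =>
  @is_deriveM R _ (fun s => heat_kernel P s x y) (cst (h y)) t 1 _ _
   (is_derive_heat_kernel_l t x y) (is_derive_cst _ _ _)).
apply; apply/esym; rewrite generatorE /heat_op.
under eq_bigr do rewrite mulr_sumr.
rewrite exchange_big /= -sumrB.
apply: eq_bigr => y _; rewrite /GRing.scale /= mulr0 add0r mulrBr mulr_sumr.
by congr (_ - _); [apply: eq_bigr => z _; ring | rewrite mulrC].
Qed.

Lemma is_derive_heat_flow (F dF : R -> T -> R) t x :
  (forall y, is_derive t 1 (fun s => F s y) (dF t y)) ->
  is_derive t 1 (fun s => heat_op s (F s) x)
    (heat_op t (fun y => generator P (F t) y + dF t y) x).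
Proof.
move=> FdF; have /is_derive_eq := is_derive_big (fun y =>
  @is_deriveM R _ (fun s => heat_kernel P s x y) (F^~ y) t 1 _ _
   (is_derive_heat_kernel_r t x y) (FdF y)).
apply; apply/esym; rewrite /heat_op /GRing.scale /=.
under eq_bigr do rewrite mulrDr.
rewrite !big_split /= [RHS]addrC; congr (_ + _).
under eq_bigr do rewrite generatorE mulrBr mulr_sumr.
rewrite sumrB exchange_big /= -sumrB.
apply: eq_bigr => y _; rewrite mulrBr mulr_sumr; congr (_ - _); last first.
  by rewrite mulrC.
by apply: eq_bigr => z _; ring.
Qed.

(* Interpolation: s |-> heat_op s (F s) x has derivative
   heat_op s (generator (F s) + dF s) x. The semigroup property, the gradient
   estimate, the local variance bound and the speed bound are all instances. *)
Lemma heat_flow_le (F dF : R -> T -> R) (C t : R) x : 0 <= t ->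
  (forall s y, 0 <= s <= t -> is_derive s 1 (fun u => F u y) (dF s y)) ->
  (forall s y, 0 <= s <= t -> generator P (F s) y + dF s y <= C) ->
  heat_op t (F t) x <= F 0 x + C * t.
Proof.
move=> t0 FdF le_C; rewrite -[F 0 x]heat_op0.
apply: (derive_le_increment (f := fun s => heat_op s (F s) x)
  (df := fun s => heat_op s (fun y => generator P (F s) y + dF s y) x)) => // s st.
  by apply: is_derive_heat_flow => y; exact: FdF.
have /andP[s0 _] := st.
by rewrite -[leRHS](heat_op_cst s C x) heat_op_le// => y; exact: le_C.
Qed.

Lemma is_derive_heat_rev t s h x :
  is_derive s 1 (fun u => heat_op (t - u) h x)
    (- generator P (heat_op (t - s) h) x).
Proof.
have D : is_derive s 1 (fun u : R => t - u) (- 1 : R).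
  have := @is_deriveB R _ _ (cst t) id s 1 0 1 (is_derive_cst _ _ _)
    (is_derive_id _ _).
  by rewrite sub0r.
have := @is_derive1_comp R (fun u => heat_op u h x) (fun u => t - u) s _ _
  (is_derive_heat_op (t - s) h x) D.
by rewrite mulrN1.
Qed.

(** The interpolation [u |-> heat_op u (heat_op (t + s - u) h)] has zero derivative. As
    [heat_flow_le] is one-sided, it is used for both [h] and [- h]. *)
Lemma heat_op_comp t s h x : 0 <= t ->
  heat_op t (heat_op s h) x = heat_op (t + s) h x.
Proof.
have le_comp g : 0 <= t -> heat_op t (heat_op s g) x <= heat_op (t + s) g x.
  move=> t0; have := heat_flow_le (F := fun u => heat_op (t + s - u) g)
    (dF := fun u y => - generator P (heat_op (t + s - u) g) y) (C := 0) x t0.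
  rewrite addrAC subrr add0r subr0 mul0r addr0; apply => u y _.
    exact: is_derive_heat_rev.
  by rewrite subrr.
move=> t0; apply/eqP; rewrite eq_le le_comp//= -lerN2.
have := le_comp (fun y => - h y) t0.
rewrite heat_opN; apply: le_trans.
rewrite -heat_opN le_eqVlt; apply/orP; left; apply/eqP.
by apply: eq_bigr => y _; rewrite heat_opN.
Qed.

Lemma heat_kernelD t s x y : 0 <= t ->
  heat_kernel P (t + s) x y = \sum_z heat_kernel P t x z * heat_kernel P s z y.
Proof.
move=> t0; have pick u z :
    heat_op u (fun w => (y == w)%:R) z = heat_kernel P u z y.
  by rewrite -[RHS](sum_indicator (heat_kernel P u z)); apply: eq_bigr => w _; rewrite mulrC.
rewrite -pick -heat_op_comp //; apply: eq_bigr => z _.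
by rewrite pick.
Qed.

End Chain.

(** * Local variance under non-negative curvature *)

Section Curvature.
Variables (R : realType) (T : finType) (P : T -> T -> R).
Hypothesis stochP : stochastic P.
Implicit Types (f g h : T -> R) (x y z : T) (t s L : R) (k : nat).

Definition edge_lipschitz L h := forall x y, 0 < P x y -> `|h x - h y| <= L.

Lemma dist_le k x y : 0 < kpow P k x y -> (dist P x y <= k)%N.
Proof.
rewrite /dist => kxy; case: pselect => // ex.
by case: ex_minnP => m _; apply.
Qed.

Lemma dist_le1 x y : 0 < P x y -> (dist P x y <= 1)%N.
Proof. by rewrite -kpow1; exact: dist_le. Qed.

Lemma kpow_dist_gt0 x y : irreducible P -> 0 < kpow P (dist P x y) x y.
Proof.
move=> irrP; rewrite /dist; case: pselect => [ex|[]]; last exact: irrP.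
by case: ex_minnP.
Qed.

Lemma edge_lipschitz_kpow L h k x y : edge_lipschitz L h ->
  0 < kpow P k x y -> `|h x - h y| <= L * k%:R.
Proof.
move=> hL; elim: k y => [|k IHk] y.
  by rewrite /=; case: eqP => [->|]; rewrite ?ltxx// subrr normr0 mulr0.
move=> /(kpowS_gt0 stochP)[z kz Pzy].
rewrite -natr1 mulrDr mulr1 (_ : h x - h y = (h x - h z) + (h z - h y)).
  by rewrite (le_trans (ler_normD _ _))// lerD ?IHk ?hL.
by rewrite addrA subrK.
Qed.

Lemma carre_du_champE f x :
  carre_du_champ P f f x = 2^-1 * \sum_y P x y * (f y - f x) ^+ 2.
Proof.
by congr (_ * _); apply: eq_bigr => y _; rewrite expr2 mulrA.
Qed.

Lemma carre_du_champ_ge0 f x : 0 <= carre_du_champ P f f x.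
Proof.
rewrite carre_du_champE mulr_ge0 ?invr_ge0// sumr_ge0// => y _.
by rewrite mulr_ge0 ?sqr_ge0 ?transition_ge0.
Qed.

Lemma carre_du_champ_lipschitz L h x : edge_lipschitz L h ->
  carre_du_champ P h h x <= L ^+ 2 / 2.
Proof.
move=> hL; rewrite carre_du_champE mulrC ler_wpM2r ?invr_ge0//.
rewrite -[leRHS]mul1r -(transition_sum stochP x) mulr_suml.
apply: ler_sum => y _.
have := transition_ge0 stochP x y; rewrite le_eqVlt => /orP[/eqP<-|Pxy].
  by rewrite !mul0r.
rewrite ler_pM2l// -[leLHS]ger0_norm ?sqr_ge0// normrX distrC.
by rewrite lerXn2r ?nnegrE ?hL// (le_trans _ (hL _ _ Pxy)).
Qed.

Lemma generator_sqr f x : generator P (fun y => f y ^+ 2) x =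
  2 * f x * generator P f x + 2 * carre_du_champ P f f x.
Proof.
rewrite carre_du_champE mulrA divff// mul1r mulr_sumr -big_split /=.
by apply: eq_bigr => y _; ring.
Qed.

(** Interpolate with [F s] the square of [heat_op (t - s) h]. By [generator_sqr] the derivative is
    the semigroup applied to twice the carré du champ of [heat_op (t - s) h], which is at most
    [L ^+ 2]. *)
Lemma heat_variance_le t L h x : 0 <= t ->
  (forall s y, 0 <= s ->
     carre_du_champ P (heat_op P s h) (heat_op P s h) y <= L ^+ 2 / 2) ->
  heat_op P t (fun y => h y ^+ 2) x - heat_op P t h x ^+ 2 <= t * L ^+ 2.
Proof.
move=> t0 GL; rewrite lerBlDl.
have := @heat_flow_le R T P stochP (fun s y => heat_op P (t - s) h y ^+ 2)
  (fun s y => 2 * heat_op P (t - s) h y * - generator P (heat_op P (t - s) h) y)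
  (L ^+ 2) t x t0.
rewrite subrr subr0 [t * _]mulrC.
rewrite (_ : (fun y => heat_op P 0 h y ^+ 2) = fun y => h y ^+ 2); last first.
  by apply/funext => y; rewrite heat_op0.
apply=> s y /andP[s0 st].
  exact: is_derive_sqr (is_derive_heat_rev stochP t s h y).
rewrite generator_sqr.
have := GL (t - s) y; rewrite subr_ge0 => /(_ st).
by set G := carre_du_champ _ _ _ _; set g := generator _ _ _; lra.
Qed.

(** Both curvatures are suprema and [trel] is an infimum; this passes from nearly optimal constants
    to the limit. *)
Lemma le_of_le_eps (a b c : R) : 0 <= b ->
  (forall e, 0 < e -> a <= c + e * b) -> a <= c.
Proof.
move=> b0 H; apply/ler_addgt0Pr => e e0.
have b1 : 0 < b + 1 by rewrite ltr_wpDl.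
apply: le_trans (H (e / (b + 1)) _) _; first by rewrite divr_gt0.
rewrite lerD2l mulrAC ler_pdivrMr// ler_pM2l// lerDl.
exact: ler01.
Qed.

Lemma bakry_emery_ge0 f x : (0 <= bakry_emery_curvature P)%E ->
  carre_du_champ P f (generator P f) x <=
    2^-1 * generator P (carre_du_champ P f f) x.
Proof.
move=> cP; apply: (le_of_le_eps (carre_du_champ_ge0 f x)) => e e0.
have : ((- e)%:E < bakry_emery_curvature P)%E.
  by apply: lt_le_trans cP; rewrite lte_fin oppr_lt0.
move=> /ereal_sup_gt[_ [kappa /(_ f x) H <-]]; rewrite lte_fin => ek.
have := carre_du_champ_ge0 f x; move: H.
set G := carre_du_champ P f f x; set u := carre_du_champ _ _ _ _.
set v := 2^-1 * _ => H G0; have : - e * G <= kappa * G by rewrite ler_wpM2r// ltW.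
lra.
Qed.

Lemma is_derive_carre_du_champ t s h y :
  let g := heat_op P (t - s) h in
  is_derive s 1 (fun u => carre_du_champ P (heat_op P (t - u) h)
     (heat_op P (t - u) h) y) (- (2 * carre_du_champ P g (generator P g) y)).
Proof.
move=> g.
have D z := is_derive_sqr
  (@is_deriveB R _ _ _ _ s 1 _ _ (is_derive_heat_rev stochP t s h z)
    (is_derive_heat_rev stochP t s h y)).
have S := is_derive_big (fun z => @is_deriveM R _ (cst (P y z)) _ s 1 _ _
   (is_derive_cst _ _ _) (D z)).
have := @is_deriveM R _ (cst 2^-1) _ s 1 _ _ (is_derive_cst _ _ _) S.
rewrite (_ : (fun u => carre_du_champ _ _ _ _) = fun u => 2^-1 * \sum_z P y z *
  (heat_op P (t - u) h z - heat_op P (t - u) h y) ^+ 2); last first.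
  by apply/funext => u; rewrite carre_du_champE.
move/is_derive_eq; apply.
rewrite /GRing.scale /= mulr0 addr0 /carre_du_champ mulrA divff// mul1r.
rewrite mulr_sumr -[RHS]sumrN; apply: eq_bigr => z _.
rewrite mulr0 addr0 !fctE -/g.
by field.
Qed.

(** Interpolate with [F s] minus the carré du champ of [heat_op (t - s) h]: the condition
    [generator (F s) + dF s <= 0] is then exactly the curvature inequality. *)
Lemma bakry_emery_gradient t h x : (0 <= bakry_emery_curvature P)%E ->
  0 <= t -> carre_du_champ P (heat_op P t h) (heat_op P t h) x <=
    heat_op P t (carre_du_champ P h h) x.
Proof.
move=> cP t0.
have := @heat_flow_le R T P stochP
  (fun s y => - carre_du_champ P (heat_op P (t - s) h) (heat_op P (t - s) h) y)
  (fun s y => 2 * carre_du_champ P (heat_op P (t - s) h)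
     (generator P (heat_op P (t - s) h)) y) 0 t x t0.
rewrite subrr subr0 mul0r addr0 heat_opN lerN2.
rewrite (_ : heat_op P 0 h = h); last by apply/funext => y; rewrite heat_op0.
apply=> s y _.
  have := is_derive_carre_du_champ t s h y.
  by move/is_deriveN; rewrite /= opprK.
rewrite generatorN; have := bakry_emery_ge0 (heat_op P (t - s) h) y cP.
by set u := generator _ _ y; set v := carre_du_champ _ _ _ y; lra.
Qed.

Lemma ollivier_ricci_wasserstein t x y : (0 <= ollivier_ricci_curvature P)%E ->
  0 <= t ->
  wasserstein P (heat_kernel P t x) (heat_kernel P t y) <= (dist P x y)%:R.
Proof.
move=> cP t0; set W := wasserstein _ _ _; set d : R := _%:R.
have d0 : 0 <= d by exact: ler0n.
have [W0|W0] := leP W 0; first exact: le_trans W0 d0.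
apply: (@le_of_le_eps _ (W * t)) => [|e e0]; first by rewrite mulr_ge0// ltW.
have : ((- e)%:E < ollivier_ricci_curvature P)%E.
  by apply: lt_le_trans cP; rewrite lte_fin oppr_lt0.
move=> /ereal_sup_gt[_ [kappa /(_ t x y t0) Hk <-]]; rewrite lte_fin => ek.
have : W <= expR (e * t) * d.
  apply: le_trans Hk _; rewrite ler_wpM2r// ler_expR ler_wpM2r//.
  by rewrite lerNl ltW.
(* Since [1 - e * t <= expR (- (e * t))], this gives [W <= d + e * (W * t)], the form required by
   [le_of_le_eps]. *)
rewrite -ler_pdivrMl ?expR_gt0// -expRN => Wd.
have := ler_wpM2r (ltW W0) (expR_ge1Dx (- (e * t))); lra.
Qed.

(** The easy half of Kantorovich duality: any coupling of the two kernels writes the difference as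
    an average of [h z - h w], bounded by [L] times the transport cost. *)
Lemma ollivier_ricci_lipschitz t L h x y : irreducible P ->
  (0 <= ollivier_ricci_curvature P)%E -> 0 <= t -> 0 < L ->
  edge_lipschitz L h ->
  `|heat_op P t h x - heat_op P t h y| <= L * (dist P x y)%:R.
Proof.
move=> irrP cP t0 L0 hL; rewrite mulrC -ler_pdivrMr//.
apply: le_trans (ollivier_ricci_wasserstein x y cP t0).
apply: lb_le_inf.
  (* The independent coupling shows that the infimum is not over the empty set. *)
  exists (\sum_z \sum_w (heat_kernel P t x z * heat_kernel P t y w) *
    (dist P z w)%:R); exists (fun z w => heat_kernel P t x z * heat_kernel P t y w) => //.
  split=> [z w|z|w].
  - by rewrite mulr_ge0 ?heat_kernel_ge0.
  - by rewrite -mulr_sumr heat_kernel_sum// mulr1.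
  - by rewrite -mulr_suml heat_kernel_sum// mul1r.
move=> _ [q [q0 q1 q2] <-]; rewrite ler_pdivrMr//.
have -> : heat_op P t h x - heat_op P t h y =
    \sum_z \sum_w q z w * (h z - h w).
  rewrite /heat_op.
  under eq_bigr do rewrite -q1 mulr_suml.
  under [X in _ - X]eq_bigr do rewrite -q2 mulr_suml.
  rewrite [X in _ - X]exchange_big /= -sumrB; apply: eq_bigr => z _.
  by rewrite -sumrB; apply: eq_bigr => w _; rewrite mulrBr.
apply: (le_trans (ler_norm_sum _ _ _)); rewrite mulr_suml; apply: ler_sum => z _.
apply: (le_trans (ler_norm_sum _ _ _)); rewrite mulr_suml; apply: ler_sum => w _.
rewrite normrM ger0_norm// -mulrA ler_wpM2l// mulrC.
by apply: edge_lipschitz_kpow => //; exact: kpow_dist_gt0.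
Qed.

(** The two notions of curvature merge here: Ollivier-Ricci preserves the Lipschitz constant,
    Bakry-Émery preserves the bound on the carré du champ, and both keep the latter below
    [L ^+ 2 / 2]. *)
Lemma nonneg_curvature_variance t L h x : irreducible P -> nonneg_curvature P ->
  0 <= t -> 0 < L -> edge_lipschitz L h ->
  heat_op P t (fun y => h y ^+ 2) x - heat_op P t h x ^+ 2 <= t * L ^+ 2.
Proof.
move=> irrP cP t0 L0 hL; apply: heat_variance_le => // s y s0.
case: cP => cP.
  apply: carre_du_champ_lipschitz => z w Pzw.
  apply: le_trans (ollivier_ricci_lipschitz z w irrP cP s0 L0 hL) _.
  by rewrite ler_piMr ?(ltW L0)// lern1 dist_le1.
apply: le_trans (bakry_emery_gradient h y cP s0) _.
rewrite -[leRHS](heat_op_cst stochP s _ y); apply: heat_op_le => // z.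
exact: carre_du_champ_lipschitz.
Qed.

End Curvature.

(** * Poincare inequality and mixing *)

Section Invariant.
Variables (R : realType) (T : finType) (P : T -> T -> R) (pi : T -> R).
Hypothesis stochP : stochastic P.
Hypothesis irrP : irreducible P.
Hypothesis invpi : invariant_law P pi.
Hypothesis cardT : (1 < #|T|)%N.
Implicit Types (f g h mu : T -> R) (x y z : T) (t s : R) (k : nat).

Lemma invariant_ge0 x : 0 <= pi x. Proof. by have [[]] := invpi. Qed.

Lemma invariant_sum : \sum_x pi x = 1. Proof. by have [[]] := invpi. Qed.

Lemma invariant_kpow k y : pi y = \sum_x pi x * kpow P k x y.
Proof.
elim: k y => [|k IHk] y.
  rewrite -[LHS](sum_indicator pi); apply: eq_bigr => x _.
  by rewrite /= mulrC eq_sym.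
under eq_bigr do rewrite kpowSr mulr_sumr.
rewrite exchange_big /=; have [_ ->] := invpi; apply: eq_bigr => x _.
by rewrite [pi x]IHk mulr_suml; apply: eq_bigr => z _; rewrite mulrA.
Qed.

Lemma invariant_gt0 y : 0 < pi y.
Proof.
have [x pix|no] := pickP (fun x => 0 < pi x); last first.
  by have := ltr01 (R := R); rewrite -invariant_sum ltNge sumr_le0// => x _; rewrite leNgt no.
have [k kxy] := irrP x y.
apply: lt_le_trans (mulr_gt0 pix kxy) _.
rewrite [leRHS](invariant_kpow k) (bigD1 x)//= lerDl sumr_ge0// => z _.
by rewrite mulr_ge0 ?invariant_ge0 ?kpow_ge0.
Qed.

Lemma mean_transition f : \sum_x pi x * (\sum_y P x y * f y) = mean_under pi f.
Proof.
under eq_bigr do rewrite mulr_sumr.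
rewrite exchange_big /=; apply: eq_bigr => y _.
have [_ ->] := invpi; rewrite mulr_suml; apply: eq_bigr => x _.
by rewrite mulrA.
Qed.

Lemma mean_generator f : mean_under pi (generator P f) = 0.
Proof.
rewrite /mean_under; under eq_bigr do rewrite generatorE// mulrBr.
by rewrite sumrB mean_transition subrr.
Qed.

(** The mean of [generator P (f ^ 2)] vanishes by invariance; expand it with [generator_sqr]. *)
Lemma dirichlet_form f :
  mean_under pi (fun x => f x * generator P f x) =
  - mean_under pi (carre_du_champ P f f).
Proof.
have E : 2 * (mean_under pi (fun x => f x * generator P f x) +
    mean_under pi (carre_du_champ P f f)) = 0.
  rewrite -[RHS](mean_generator (fun x => f x ^+ 2)) mulrDr !mulr_sumr -big_split.
  by apply: eq_bigr => x _; rewrite generator_sqr /=; ring.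
by apply/eqP; rewrite -addr_eq0; move/eqP: E; rewrite mulf_eq0 pnatr_eq0.
Qed.

Lemma mean_ge0 f : (forall x, 0 <= f x) -> 0 <= mean_under pi f.
Proof. by move=> f0; apply: sumr_ge0 => x _; rewrite mulr_ge0 ?invariant_ge0. Qed.

Lemma mean_le f g : (forall x, f x <= g x) -> mean_under pi f <= mean_under pi g.
Proof. by move=> fg; apply: ler_sum => x _; rewrite ler_wpM2l ?invariant_ge0. Qed.

Lemma mean_cst (c : R) : mean_under pi (fun=> c) = c.
Proof. by rewrite /mean_under -mulr_suml invariant_sum mul1r. Qed.

Lemma energy_ge0 f : 0 <= mean_under pi (carre_du_champ P f f).
Proof. by apply: mean_ge0 => x; exact: carre_du_champ_ge0. Qed.

(** * The relaxation time as a genuine optimal constant *)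

(** The energy controls the increment of [f] across each edge, hence along paths, hence its
    oscillation and its variance. The infimum defining [trel] is thus over a nonempty set. *)
Lemma poincare_constant_exists :
  exists c, forall f, var_under pi f <= c * mean_under pi (carre_du_champ P f f).
Proof.
(* Summing gives a crude maximum over edges; non-edges contribute 0, the inverse of 0 being 0. *)
pose K := \sum_x \sum_y (pi x * P x y)^-1.
pose D : R := \sum_x \sum_y (dist P x y)%:R.
have D0 : 0 <= D by apply: sumr_ge0 => x _; apply: sumr_ge0.
have distD x y : (dist P x y)%:R <= D.
  rewrite /D (bigD1 x)//= (bigD1 y)//= -addrA lerDl addr_ge0//.
    by apply: sumr_ge0.
  by apply: sumr_ge0 => ? _; apply: sumr_ge0.
have w0 x y : 0 <= (pi x * P x y)^-1.
  by rewrite invr_ge0 mulr_ge0 ?invariant_ge0 ?transition_ge0.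
have leK x y : (pi x * P x y)^-1 <= K.
  rewrite /K (bigD1 x)//= (bigD1 y)//= -addrA lerDl addr_ge0//.
    by apply: sumr_ge0.
  by apply: sumr_ge0 => ? _; apply: sumr_ge0.
exists (D ^+ 2 * (2 * K)) => f.
set E := mean_under pi _; have E0 : 0 <= E := energy_ge0 f.
have K0 : 0 <= K by apply: sumr_ge0 => x _; apply: sumr_ge0.
have fL : edge_lipschitz P (Num.sqrt (2 * K * E)) f.
  move=> x y Pxy; rewrite -sqrtr_sqr ler_wsqrtr//.
  have c0 : 0 < pi x * P x y by rewrite mulr_gt0 ?invariant_gt0.
  have Exy : pi x * P x y * (f x - f y) ^+ 2 <= 2 * E.
    rewrite /E /mean_under; under eq_bigr do rewrite carre_du_champE mulrCA.
    rewrite -mulr_sumr mulrA divff// mul1r (bigD1 x)//= (bigD1 y)//= mulrDr.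
    rewrite -addrA -mulrA; set a := (f x - f y) ^+ 2.
    have -> : (f y - f x) ^+ 2 = a by rewrite /a; ring.
    rewrite lerDl addr_ge0//.
      rewrite mulr_ge0 ?invariant_ge0// sumr_ge0// => z _.
      by rewrite mulr_ge0 ?sqr_ge0 ?transition_ge0.
    apply: sumr_ge0 => z _; rewrite mulr_ge0 ?invariant_ge0// sumr_ge0// => w _.
    by rewrite mulr_ge0 ?sqr_ge0 ?transition_ge0.
  rewrite -ler_pdivlMl// in Exy; apply: (le_trans Exy).
  have -> : 2 * K * E = K * (2 * E) by ring.
  by rewrite ler_wpM2r ?leK// mulr_ge0.
pose L := Num.sqrt (2 * K * E) * D.
have L0 : 0 <= L by rewrite mulr_ge0 ?sqrtr_ge0.
have fxy x y : `|f x - f y| <= L.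
  apply: le_trans (edge_lipschitz_kpow stochP fL (kpow_dist_gt0 x y irrP)) _.
  by rewrite ler_wpM2l ?sqrtr_ge0.
rewrite (_ : D ^+ 2 * _ * E = L ^+ 2); last first.
  by rewrite /L exprMn sqr_sqrtr ?mulr_ge0//; ring.
rewrite -[leRHS]mean_cst; apply: mean_le => x.
rewrite -[leLHS]ger0_norm ?sqr_ge0// normrX lerXn2r ?nnegrE//.
rewrite (_ : f x - _ = \sum_y pi y * (f x - f y)); last first.
  under eq_bigr do rewrite mulrBr.
  by rewrite sumrB -mulr_suml invariant_sum mul1r.
apply: (le_trans (ler_norm_sum _ _ _)); rewrite -[leRHS]mean_cst.
by apply: ler_sum => y _; rewrite normrM ger0_norm ?invariant_ge0// ler_wpM2l ?invariant_ge0.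
Qed.

(** From [(a - b) ^ 2 <= 2 * (a ^ 2 + b ^ 2)] applied to centered values, both endpoints of a
    stationary jump having law [pi]. *)
Lemma energy_le_var f :
  mean_under pi (carre_du_champ P f f) <= 2 * var_under pi f.
Proof.
set m := mean_under pi f.
pose g x := (f x - m) ^+ 2.
apply: (@le_trans _ _ (\sum_x pi x * (\sum_y P x y * g y + g x))).
  apply: ler_sum => x _; rewrite ler_wpM2l ?invariant_ge0// carre_du_champE.
  have -> : g x = \sum_y P x y * g x by rewrite -mulr_suml transition_sum ?mul1r.
  rewrite -big_split /= mulr_sumr; apply: ler_sum => y _.
  rewrite mulrCA -mulrDr ler_wpM2l ?transition_ge0// /g.
  have := sqr_ge0 ((f x - m) + (f y - m)); nra.
under eq_bigr do rewrite mulrDr.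
rewrite big_split /= mean_transition /var_under -/g -/m.
by rewrite /mean_under; lra.
Qed.

Lemma exists_var_gt0 : exists f, 0 < var_under pi f.
Proof.
have /card_gt1P[x [y [_ _ xy]]] := cardT.
pose f z : R := (z == x)%:R; exists f; set m := mean_under pi f.
have [z fz] : exists z, f z != m.
  have [fm|] := eqVneq (f x) m; last by exists x.
  by exists y; rewrite -fm /f eqxx [y == x]eq_sym (negbTE xy) eq_sym oner_eq0.
rewrite /var_under /mean_under (bigD1 z)//= ltr_pwDl//.
  by rewrite mulr_gt0 ?invariant_gt0// lt0r sqr_ge0 expf_eq0 /= subr_eq0 fz.
by apply: sumr_ge0 => w _; rewrite mulr_ge0 ?invariant_ge0 ?sqr_ge0.
Qed.

(** Bounds the admissible constants from below, so that [trel] is a true infimum; the value 1/2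
    later makes powers of [trel] comparable. *)
Lemma poincare_constant_ge_half c :
  (forall f, var_under pi f <= c * mean_under pi (carre_du_champ P f f)) ->
  2^-1 <= c.
Proof.
move=> cP; have [f f0] := exists_var_gt0.
have := energy_le_var f; have := cP f.
have := energy_ge0 f; rewrite le_eqVlt => /orP[/eqP <-|E0 ? ?].
  by rewrite mulr0 leNgt f0.
by rewrite leNgt; apply/negP => ?; nra.
Qed.

Lemma trel_ge_half : 2^-1 <= trel P pi.
Proof.
apply: lb_le_inf => [|c]; last exact: poincare_constant_ge_half.
by have [c cP] := poincare_constant_exists; exists c.
Qed.

Lemma trel_gt0 : 0 < trel P pi.
Proof. by apply: lt_le_trans trel_ge_half; rewrite invr_gt0. Qed.

Lemma trel_poincare f :
  var_under pi f <= trel P pi * mean_under pi (carre_du_champ P f f).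
Proof.
apply: (le_of_le_eps (energy_ge0 f)) => e e0.
have [|c cP ce] := @inf_adherent R [set c : R | forall f,
    var_under pi f <= c * mean_under pi (carre_du_champ P f f)] e e0.
  split; first by have [c cP] := poincare_constant_exists; exists c.
  by exists 2^-1 => c; exact: poincare_constant_ge_half.
by rewrite -mulrDl (le_trans (cP f))// ler_wpM2r ?energy_ge0// ltW.
Qed.

Lemma mean_heat_op t h : mean_under pi (heat_op P t h) = mean_under pi h.
Proof.
transitivity (mean_under pi (heat_op P 0 h)); last first.
  by apply: eq_bigr => x _; rewrite heat_op0.
apply: (@is_derive_0_is_cst R (fun s => mean_under pi (heat_op P s h))) => s.
have /is_derive_eq := is_derive_big (fun x =>
  @is_deriveM R _ (cst (pi x)) _ s 1 _ _ (is_derive_cst _ _ _)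
    (is_derive_heat_op stochP s h x)); apply.
rewrite -[RHS](mean_generator (heat_op P s h)).
by apply: eq_bigr => x _; rewrite /GRing.scale /= mulr0 addr0.
Qed.

(** Grönwall: the variance has derivative minus twice the energy, so by Poincaré its product with
    [expR (2 / tau * s)] is nonincreasing. *)
Lemma var_heat_op_le t h : 0 <= t ->
  var_under pi (heat_op P t h) <= expR (- (2 * t / trel P pi)) * var_under pi h.
Proof.
move=> t0; set tau := trel P pi; set m := mean_under pi h.
pose phi s := \sum_x pi x * (heat_op P s h x - m) ^+ 2.
have phiE s : var_under pi (heat_op P s h) = phi s.
  by rewrite /var_under mean_heat_op.
have dphi s : is_derive s 1 phi
    (- (2 * mean_under pi (carre_du_champ P (heat_op P s h) (heat_op P s h)))).
  have D x := is_derive_sqr (@is_deriveB R _ _ _ _ s 1 _ _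
    (is_derive_heat_op stochP s h x) (is_derive_cst m _ _)).
  have /is_derive_eq := is_derive_big (fun x =>
    @is_deriveM R _ (cst (pi x)) _ s 1 _ _ (is_derive_cst _ _ _) (D x)); apply.
  transitivity (2 * mean_under pi (fun x => heat_op P s h x *
      generator P (heat_op P s h) x) -
    2 * m * mean_under pi (generator P (heat_op P s h))); last first.
    by rewrite dirichlet_form mean_generator; ring.
  rewrite [X in _ = X - _]mulr_sumr [X in _ = _ - X]mulr_sumr -[RHS]sumrB.
  by apply: eq_bigr => x _; rewrite /GRing.scale /= !fctE; ring.
have := @derive_le_increment R
  (fun s => expR (2 / tau * s) * phi s)
  (fun s => expR (2 / tau * s) * (2 / tau * phi s -
    2 * mean_under pi (carre_du_champ P (heat_op P s h) (heat_op P s h)))) 0 t t0.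
rewrite mulr0 expR0 mul1r mul0r addr0 -!phiE.
have -> : var_under pi (heat_op P 0 h) = var_under pi h.
  by congr var_under; apply/funext => x; rewrite heat_op0.
move=> H; rewrite expRN ler_pdivlMl ?expR_gt0//.
rewrite (mulrAC 2 t); apply: H => [s _|s _].
  have E : is_derive s 1 (fun u => expR (2 / tau * u))
      (expR (2 / tau * s) * (2 / tau)).
    have L : is_derive s 1 (fun u : R => 2 / tau * u) (2 / tau : R).
      have /is_derive_eq := @is_deriveZ R _ _ id (2 / tau) s 1 1 (is_derive_id _ _).
      by apply; rewrite /GRing.scale /= mulr1.
    exact: (@is_derive1_comp R expR (fun u => 2 / tau * u) s _ _ _ L).
  have /is_derive_eq := @is_deriveM R _ _ _ s 1 _ _ E (dphi s); apply.
  by rewrite /GRing.scale /=; ring.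
rewrite mulr_ge0_le0 ?expR_ge0// -phiE subr_le0 mulrAC -mulrA.
rewrite ler_pM2l// ler_pdivrMr ?trel_gt0// mulrC.
exact: trel_poincare.
Qed.

(** * From concentration of the log-density to mixing *)

Lemma tv_distP mu nu (e : R) : 0 <= e ->
  tv_dist mu nu <= e <->
  forall A : {set T}, `|\sum_(x in A) mu x - \sum_(x in A) nu x| <= e.
Proof.
move=> e0; split=> [le_e A|le_e]; last by apply: bigmax_le.
apply: le_trans le_e.
exact: (le_bigmax _ (fun A : {set T} => `|\sum_(x in A) mu x - \sum_(x in A) nu x|)).
Qed.

(* The part of mu whose density exceeds expR M is thrown away; the rest is paired
   with the centered function heat_op s 1_A, whose L^2(pi) norm has decayed. *)
Lemma mixing_of_density_tail mu (M e s : R) : probability_vector mu ->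
  0 < e -> 0 <= s ->
  \sum_(x | expR M * pi x < mu x) mu x <= e / 4 ->
  expR (M - 2 * s / trel P pi) <= e ^+ 2 / 4 ->
  tv_dist (fun y => \sum_x mu x * heat_kernel P s x y) pi <= e.
Proof.
move=> [mu0 mu1] e0 s0 tail small; apply/tv_distP => [|A]; first exact: ltW.
pose h y : R := (y \in A)%:R; pose g := heat_op P s h.
pose m := mean_under pi h.
have setE f : \sum_(y in A) f y = \sum_y f y * h y.
  by rewrite big_mkcond; apply: eq_bigr => y _; rewrite /h; case: ifP; rewrite ?mulr1 ?mulr0.
have -> : \sum_(y in A) \sum_x mu x * heat_kernel P s x y - \sum_(y in A) pi y =
    \sum_x mu x * (g x - m).
  rewrite !setE; under [RHS]eq_bigr do rewrite mulrBr.
  rewrite sumrB -[X in _ = _ - X]mulr_suml mu1 mul1r; congr (_ - _).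
  under eq_bigr do rewrite mulr_suml.
  rewrite exchange_big /=; apply: eq_bigr => x _.
  by rewrite /g /heat_op mulr_sumr; apply: eq_bigr => y _; rewrite -[LHS]mulrA.
have h01 y : 0 <= h y <= 1 by rewrite ler0n lern1 leq_b1.
have g01 x : 0 <= g x <= 1.
  apply/andP; split.
    by rewrite -(heat_op_cst stochP s 0 x) heat_op_le// => y; have /andP[] := h01 y.
  by rewrite -[leRHS](heat_op_cst stochP s 1 x) heat_op_le// => y; have /andP[] := h01 y.
have m01 : 0 <= m <= 1.
  apply/andP; split; first by apply: mean_ge0 => y; have /andP[] := h01 y.
  by rewrite -[leRHS]mean_cst; apply: mean_le => y; have /andP[] := h01 y.
have var1 : var_under pi h <= 1.
  rewrite -[leRHS]mean_cst; apply: mean_le => y; rewrite -/m.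
  by have /andP[? ?] := h01 y; case/andP: m01 => ? ?; nra.
have varg : expR M * var_under pi g <= e ^+ 2 / 4.
  apply: le_trans small; rewrite expRD ler_wpM2l ?expR_ge0//.
  apply: le_trans (var_heat_op_le h s0) _.
  by rewrite ler_piMr ?expR_ge0.
have varE : var_under pi g = \sum_x pi x * (g x - m) ^+ 2.
  by rewrite /var_under mean_heat_op.
(* AM-GM: |u| <= e / 4 + u ^ 2 / e *)
have pw x : mu x * `|g x - m| <= (if expR M * pi x < mu x then mu x else 0) +
    (mu x * (e / 4) + expR M * (pi x * (g x - m) ^+ 2) / e).
  have u1 : `|g x - m| <= 1.
    by rewrite ler_norml; have /andP[? ?] := g01 x; case/andP: m01 => ? ?; lra.
  have u0 : 0 <= `|g x - m| by [].
  rewrite -(real_normK (num_real (g x - m))); set u := `|_| in u0 u1 *.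
  have q0 : 0 <= u ^+ 2 / e by rewrite divr_ge0 ?sqr_ge0// ltW.
  have := mu0 x; case: ltP => [_|good] mux.
    rewrite ler_wpDr ?ler_piMr// addr_ge0//.
      by rewrite mulr_ge0// divr_ge0// ltW.
    by rewrite divr_ge0 ?(ltW e0)// mulr_ge0 ?expR_ge0// mulr_ge0 ?invariant_ge0 ?sqr_ge0.
  rewrite add0r; apply: (@le_trans _ _ (mu x * (e / 4 + u ^+ 2 / e))).
    rewrite ler_wpM2l//.
    have uE : u = e / 4 + u ^+ 2 / e - (u - e / 2) ^+ 2 / e by field; rewrite gt_eqF.
    by rewrite [leLHS]uE gerBl divr_ge0 ?sqr_ge0// ltW.
  rewrite mulrDr lerD2l (_ : expR M * _ / e = expR M * pi x * (u ^+ 2 / e)).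
    by rewrite ler_wpM2r.
  by rewrite !mulrA.
apply: (le_trans (ler_norm_sum _ _ _)).
under eq_bigr => x _ do rewrite normrM (ger0_norm (mu0 x)).
apply: (le_trans (ler_sum _ (fun x _ => pw x))).
rewrite big_split /= -big_mkcond /= big_split /= -mulr_suml mu1 mul1r.
rewrite -mulr_suml -mulr_sumr -varE.
have : expR M * var_under pi g / e <= e / 4.
  by rewrite ler_pdivrMr// mulrAC -expr2.
lra.
Qed.

(** Chebyshev places [psi] within [r] of its mean [m] off a set of mass [e / 4]. It remains to bound
    [m] by [r + ln (2 / e)], which is where the total variation bound enters. *)
Lemma density_tail_of_variance mu (e r : R) : probability_vector mu ->
  (forall x, 0 < mu x) -> 0 < e -> e <= 1 -> 0 < r ->
  let psi x := ln (mu x / pi x) in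
  \sum_x mu x * psi x ^+ 2 - (\sum_x mu x * psi x) ^+ 2 <= e / 4 * r ^+ 2 ->
  tv_dist mu pi <= 1 - e ->
  \sum_(x | expR (2 * r + ln (2 / e)) * pi x < mu x) mu x <= e / 4.
Proof.
move=> [mu0 mu1] mup e0 e1 r0 psi; set m := \sum_x mu x * psi x => V /tv_distP tv.
have psiE x : mu x = expR (psi x) * pi x.
  by rewrite lnK ?posrE ?divr_gt0 ?invariant_gt0// divfK// gt_eqF ?invariant_gt0.
have cheb (Q : pred T) : (forall x, Q x -> r ^+ 2 <= (psi x - m) ^+ 2) ->
    \sum_(x | Q x) mu x <= e / 4.
  move=> Qr; rewrite -(ler_pM2r (exprn_gt0 2 r0)).
  apply: le_trans V; rewrite mulr_suml.
  have -> : \sum_x mu x * psi x ^+ 2 - m ^+ 2 = \sum_x mu x * (psi x - m) ^+ 2.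
    transitivity (\sum_x (mu x * psi x ^+ 2 - 2 * m * (mu x * psi x) + m ^+ 2 * mu x)).
      by rewrite big_split sumrB /= -!mulr_sumr mu1 -/m; ring.
    by apply: eq_bigr => x _; ring.
  rewrite [leRHS](bigID Q) /= -[leLHS]addr0 lerD//.
    by apply: ler_sum => x Qx; rewrite ler_wpM2l ?Qr.
  by apply: sumr_ge0 => x _; rewrite mulr_ge0 ?sqr_ge0.
(* The set [psi >= m - r] has [mu]-mass at least [1 - e / 4] and [pi]-mass at most [expR (r - m)].
   The gap being at most [1 - e], [expR (r - m)] is at least [3 * e / 4], weakened to [e / 2]. *)
have m_le : m <= r + ln (2 / e).
  pose A : {set T} := [set x | m - r <= psi x]%SET.
  have e1' : 0 <= 1 - e by rewrite subr_ge0.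
  have := le_trans (ler_norm _) (tv e1' A).
  have muA : 1 - e / 4 <= \sum_(x in A) mu x.
    rewrite lerBlDr -[leLHS]mu1 (bigID (mem A)) /= lerD2l; apply: cheb => x.
    by rewrite inE -ltNge => h; nra.
  have piA : \sum_(x in A) pi x <= expR (r - m).
    rewrite -[leRHS]mulr1 -mu1 mulr_sumr big_mkcond /=; apply: ler_sum => x _.
    rewrite inE; case: ifP => [h|_]; last by rewrite mulr_ge0 ?expR_ge0.
    rewrite psiE mulrA -expRD ler_peMl ?invariant_ge0// -expR0 ler_expR; lra.
  move=> AA; have : e / 2 <= expR (r - m) by lra.
  rewrite -[e / 2]lnK ?posrE ?divr_gt0// ler_expR -[e / 2]invf_div lnV ?posrE ?divr_gt0//.
  lra.
apply: cheb => x; rewrite psiE ltr_pM2r ?invariant_gt0// ltr_expR => h.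
nra.
Qed.

(** With [M = 2 * r + ln (2 / e)], the smallness condition of [mixing_of_density_tail] asks for
    [s >= trel * (r + 3 / 2 * ln (2 / e))]; the 3/2 is rounded up to 2. *)
Lemma mixing_of_variance t s o (e r : R) : 0 <= t -> 0 < e -> e <= 1 -> 0 < r ->
  (forall x, 0 < heat_kernel P t o x) ->
  let psi x := ln (heat_kernel P t o x / pi x) in
  heat_op P t (fun x => psi x ^+ 2) o - heat_op P t psi o ^+ 2 <= e / 4 * r ^+ 2 ->
  tv_dist (heat_kernel P t o) pi <= 1 - e ->
  trel P pi * (r + 2 * ln (2 / e)) <= s ->
  tv_dist (heat_kernel P (t + s) o) pi <= e.
Proof.
move=> t0 e0 e1 r0 Hp psi V tv sl.
have l0 : 0 <= ln (2 / e) by rewrite ln_ge0// ler_pdivlMr// mul1r (le_trans e1)// ler1n.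
have s0 : 0 <= s.
  by apply: le_trans sl; rewrite mulr_ge0 ?(ltW trel_gt0)// addr_ge0 ?(ltW r0)// mulr_ge0.
have pv : probability_vector (heat_kernel P t o).
  by split=> [x|]; [exact: heat_kernel_ge0 | exact: heat_kernel_sum].
have tail := density_tail_of_variance pv Hp e0 e1 r0 V tv.
have := mixing_of_density_tail pv e0 s0 tail.
rewrite (_ : (fun y => \sum_x _) = heat_kernel P (t + s) o); last first.
  by apply/funext => y; rewrite heat_kernelD.
apply; rewrite -[_ ^+ 2 / 4]lnK ?posrE ?divr_gt0 ?exprn_gt0// ler_expR.
have -> : e ^+ 2 / 4 = ((2 / e) ^+ 2)^-1 by field; rewrite gt_eqF.
rewrite lnV ?posrE ?exprn_gt0 ?divr_gt0// lnXn ?divr_gt0//.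
have : r + 2 * ln (2 / e) <= s / trel P pi.
  by rewrite ler_pdivlMr ?trel_gt0// mulrC.
rewrite mulr2n; lra.
Qed.

End Invariant.

(** * Distance, sparsity and the Harnack inequality *)

Section Sparse.
Variables (R : realType) (T : finType) (P : T -> T -> R) (pi : T -> R).
Hypothesis stochP : stochastic P.
Hypothesis irrP : irreducible P.
Hypothesis invpi : invariant_law P pi.
Hypothesis symP : symmetric_support P.
Hypothesis cardT : (3 <= #|T|)%N.
Implicit Types (o x y z : T) (t : R) (k : nat).

Local Notation Delta := (sparsity P).

Lemma dist_triangle x y z : (dist P x y <= dist P x z + dist P z y)%N.
Proof.
apply: dist_le => //; exact: kpow_gt0_trans (kpow_dist_gt0 _ _ irrP)
  (kpow_dist_gt0 _ _ irrP).
Qed.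

Lemma kpow_sym k x y : 0 < kpow P k x y -> 0 < kpow P k y x.
Proof.
elim: k y => [|k IHk] y; first by rewrite /= eq_sym.
move=> /(kpowS_gt0 stochP)[z kz /symP Pyz].
by rewrite -add1n; apply: kpow_gt0_trans (IHk _ kz); rewrite // kpow1.
Qed.

Lemma dist_sym x y : dist P x y = dist P y x.
Proof. by apply/eqP; rewrite eqn_leq !dist_le// kpow_sym// kpow_dist_gt0. Qed.

Lemma dist_refl x : dist P x x = 0%N.
Proof. by apply/eqP; rewrite -leqn0 dist_le//= eqxx ltr01. Qed.

Lemma dist_gt0 x y : x != y -> (0 < dist P x y)%N.
Proof.
move=> xy; rewrite lt0n; apply/eqP => d0.
have := kpow_dist_gt0 x y irrP; rewrite d0 /= (negbTE xy).
by rewrite ltxx.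
Qed.

Lemma dist_edge_lipschitz o : edge_lipschitz P 1 (fun y => (dist P o y)%:R).
Proof.
move=> x y Pxy.
have step z w : (dist P z w <= 1)%N ->
    (dist P o w)%:R <= (dist P o z)%:R + 1 :> R.
  move=> zw; rewrite natr1 ler_nat (leq_trans (dist_triangle _ _ z))//.
  by rewrite -[X in (_ <= X)%N]addn1 leq_add2l.
have xy := dist_le1 Pxy; have yx : (dist P y x <= 1)%N by rewrite dist_sym.
by have := step _ _ xy; have := step _ _ yx; rewrite ler_norml; lra.
Qed.

Lemma neighborP x y : reflect (x != y /\ 0 < P x y) (neighbor P x y).
Proof.
apply: (iffP eqP) => [d1|[xy Pxy]].
  split; first by apply: contra_eq_neq d1 => ->; rewrite dist_refl.
  by rewrite -kpow1 -d1; exact: kpow_dist_gt0.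
by apply/eqP; rewrite eqn_leq dist_le1// dist_gt0.
Qed.

(** Neighbors are at distance exactly 1, so [sparsity] says nothing about loops [P x x]. *)
Lemma inv_le_sparsity x y : x != y -> 0 < P x y -> (P x y)^-1 <= Delta.
Proof.
move=> xy Pxy; have nxy : neighbor P x y by apply/neighborP.
exact: (le_bigmax_cond _ (fun xy : T * T => (P xy.1 xy.2)^-1) (j := (x, y))).
Qed.

(* If Delta < 2, every point has at most one neighbor, so that the component of
   any point has at most two elements. *)
Lemma sparsity_ge2 : 2 <= Delta.
Proof.
rewrite leNgt; apply/negP => D2.
have big x y : x != y -> 0 < P x y -> 2^-1 < P x y.
  move=> xy Pxy; rewrite -[P x y]invrK ltf_pV2 ?posrE ?invr_gt0//.
  exact: le_lt_trans (inv_le_sparsity xy Pxy) D2.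
have uniq_neighbor x y z : x != y -> x != z -> 0 < P x y -> 0 < P x z -> y = z.
  move=> xy xz Pxy Pxz; apply/eqP; apply: contraT => yz.
  have := transition_sum stochP x; rewrite (bigD1 y)//= (bigD1 z) 1?eq_sym//=.
  have : 0 <= \sum_(i | (i != y) && (i != z)) P x i.
    by apply: sumr_ge0 => i _; exact: transition_ge0.
  by have := big _ _ xy Pxy; have := big _ _ xz Pxz; lra.
have reach k x y : 0 < kpow P k x y -> y = x \/ 0 < P x y.
  elim: k y => [|k IHk] y; first by rewrite /=; case: eqP => [->|]; [left|rewrite ltxx].
  move=> /(kpowS_gt0 stochP)[z kz Pzy].
  have [zx|Pxz] := IHk _ kz; first by right; rewrite -zx.
  have [zx|zx] := eqVneq z x; first by right; rewrite -zx.
  have [zy|zy] := eqVneq z y; first by right; rewrite -zy.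
  by left; apply: (uniq_neighbor z) => //; exact/symP.
have /card_gt2P[x [y [z [_ [xy yz zx]]]]] := cardT.
have adj w : x != w -> 0 < P x w.
  move=> xw; have [k kw] := irrP x w.
  by have [wx|//] := reach _ _ _ kw; rewrite wx eqxx in xw.
have xz : x != z by rewrite eq_sym.
by move: yz; rewrite (uniq_neighbor _ _ _ xy xz (adj _ xy) (adj _ xz)) eqxx.
Qed.

Lemma sparsity_gt0 : 0 < Delta.
Proof. by apply: lt_le_trans sparsity_ge2. Qed.

Lemma sparsity_inv_le x y : x != y -> 0 < P x y -> Delta^-1 <= P x y.
Proof.
move=> xy Pxy; rewrite -[leRHS]invrK lef_pV2 ?posrE ?invr_gt0 ?sparsity_gt0//.
exact: inv_le_sparsity.
Qed.

(** A geodesic has no loop, so each of its steps has probability at least [Delta^-1]. *)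
Lemma kpow_dist_ge x y : Delta^-1 ^+ dist P x y <= kpow P (dist P x y) x y.
Proof.
move: {2 3 4}(dist P x y) (erefl (dist P x y)) => k.
elim: k y => [|k IHk] y dk.
  rewrite expr0 /=; case: eqP => // /eqP /dist_gt0; by rewrite dk.
have := kpow_dist_gt0 x y irrP; rewrite dk => /(kpowS_gt0 stochP)[z kz Pzy].
have dz : dist P x z = k.
  apply/eqP; rewrite eqn_leq dist_le//= -ltnS -dk.
  by rewrite (leq_trans (dist_triangle _ _ z))// -addn1 leq_add2l dist_le1.
have zy : z != y.
  by apply/eqP => zy; move: dk; rewrite -zy dz => /n_Sn.
rewrite -addn1 exprD expr1; apply: le_trans (kpowD_ge stochP _ _ _ _ z).
rewrite kpow1 ler_pM ?exprn_ge0 ?invr_ge0 ?(ltW sparsity_gt0)// ?IHk//.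
exact: sparsity_inv_le.
Qed.

Lemma heat_kernel_gt0 t x y : 0 < t -> 0 < heat_kernel P t x y.
Proof.
move=> t0; apply: lt_le_trans (heat_kernel_ge stochP x y (dist P x y) (ltW t0)).
rewrite mulr_gt0 ?expR_gt0// divr_gt0 ?ltr0n ?fact_gt0//.
by rewrite mulr_gt0 ?exprn_gt0 ?kpow_dist_gt0.
Qed.

(** From [k! <= k ^ k]. *)
Lemma expr_div_fact_ge (a t : R) k : 0 <= a -> a * k%:R <= t ->
  a ^+ k <= t ^+ k / k`!%:R.
Proof.
move=> a0 akt; rewrite ler_pdivlMr ?ltr0n ?fact_gt0//.
apply: (@le_trans _ _ ((a * k%:R) ^+ k)); last first.
  by rewrite lerXn2r ?nnegrE ?mulr_ge0// (le_trans _ akt)// mulr_ge0.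
rewrite exprMn ler_wpM2l ?exprn_ge0// -natrX ler_nat.
elim: k {akt} => // -[//|k] IHk.
by rewrite factS expnS leq_mul2l /= (leq_trans IHk)// leq_exp2r.
Qed.

Lemma kpow_term_ge (a t : R) x y : 0 <= a -> a * (dist P x y)%:R <= t ->
  (a / Delta) ^+ dist P x y <=
    kpow P (dist P x y) x y * t ^+ dist P x y / (dist P x y)`!%:R.
Proof.
move=> a0 at_; rewrite exprMn mulrC -mulrA ler_pM ?exprn_ge0 ?invr_ge0 ?kpow_dist_ge//.
  by rewrite ltW// sparsity_gt0.
exact: expr_div_fact_ge.
Qed.

(* At time D, the kernel puts mass at least (e Delta)^-D on every point. *)
Lemma card_le_diam (D : nat) : (forall x y, (dist P x y <= D)%N) ->
  #|T|%:R <= expR (D%:R * (1 + ln Delta)).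
Proof.
move=> leD; rewrite mulrDr mulr1 expRD expRM_natl lnK ?posrE ?sparsity_gt0//.
have D1 : 1 <= Delta by apply: le_trans sparsity_ge2; rewrite ler1n.
have /card_gt0P[ o _] : (0 < #|T|)%N by rewrite (leq_trans _ cardT).
have Dn0 : (0 : R) <= D%:R by [].
have Hge x : expR (- D%:R) * Delta^-1 ^+ D <= heat_kernel P D%:R o x.
  apply: le_trans (heat_kernel_ge stochP o x (dist P o x) Dn0).
  rewrite ler_wpM2l ?expR_ge0//.
  have := @kpow_term_ge 1 D%:R o x ler01; rewrite mul1r ler_nat leD => /(_ isT).
  apply: le_trans; rewrite div1r ler_wiXn2l ?invr_ge0 ?(ltW sparsity_gt0)//.
  by rewrite invf_le1 ?sparsity_gt0.
have : \sum_(x : T) expR (- D%:R) * Delta^-1 ^+ D <= 1.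
  by rewrite -[leRHS](heat_kernel_sum stochP D%:R o); apply: ler_sum.
rewrite sumr_const -[_ *+ _]mulr_natr expRN exprVn -invfM mulrC.
by rewrite ler_pdivrMr ?mul1r// mulr_gt0 ?expR_gt0 ?exprn_gt0 ?sparsity_gt0.
Qed.

(** * Harnack inequality and regularity of the log-density *)

(** In the Harnack proof the bracket bounds [(M + 1) / (t * Delta)], [M] being the truncation level;
    the factor 2 pays for absorbing the discarded half. *)
Definition harnack_const (a : R) : R := 2 * (expR 1 + 2 / a + a^-1 ^+ 2).

Lemma harnack_const_ge1 (a : R) : 0 < a -> 1 <= harnack_const a.
Proof.
move=> a0; have := expR_ge1Dx (1 : R).
have : 0 <= 2 / a by rewrite divr_ge0// ltW.
have := sqr_ge0 (a^-1); rewrite /harnack_const; lra.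
Qed.

(* A last jump from x to y compares the (k+1)-step term at y with the k-step term
   at x up to a factor (k + 1) / (p t). Terms with k > M jumps are dominated by an
   exponential Chernoff bound, and M is chosen so that they sum to at most half of
   the total, given the lower bound (a / Delta)^d on this total. *)
Lemma heat_kernel_harnack (a t : R) o x y : 0 < a -> a <= 1 ->
  (forall z, a * (dist P o z)%:R <= t) -> a <= t -> 0 < P x y ->
  heat_kernel P t o x <= harnack_const a * Delta ^+ 2 * heat_kernel P t o y.
Proof.
move=> a0 a1 dt at_ Pxy.
have t0 : 0 < t by exact: lt_le_trans at_.
have D2 := sparsity_ge2; have C1 := harnack_const_ge1 a0.
(* Loops are treated apart because [sparsity] does not bound [(P x x)^-1]. *)
have [<-|xy] := eqVneq x y.
  rewrite ler_peMl ?heat_kernel_ge0 ?ltW//; nra.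
rewrite !heat_kernelE mulrCA ler_wpM2l ?expR_ge0//.
set p := P x y; set d := dist P o x.
set Sx := egf _ t; set Sy := egf _ t.
have k01 z k : 0 <= kpow P k o z <= 1 by rewrite kpow_ge0 ?kpow_le1.
have Sy0 : 0 <= Sy.
  apply: le_trans (egf_term_le (c := fun k => kpow P k o y) 0 (k01 y) (ltW t0)).
  by rewrite !mulr_ge0 ?exprn_ge0 ?kpow_ge0 ?invr_ge0// ltW.
(* Chosen so that the tail [expR (expR 1 * t - M)] equals half of [(a / Delta) ^ d]. *)
pose M := expR 1 * t + (ln 2 + d%:R * ln (Delta / a)).
have aD : 1 <= Delta / a by rewrite ler_pdivlMr// mul1r; lra.
have lnaD : 0 <= ln (Delta / a) by exact: ln_ge0.
have M0 : 0 <= M.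
  by rewrite !addr_ge0 ?mulr_ge0 ?expR_ge0 ?ln_ge0 ?ler1n// ltW.
have pt0 : 0 < p * t by exact: mulr_gt0.
have K0 : 0 <= (M + 1) / (p * t).
  by apply: divr_ge0; [exact: addr_ge0 | exact: ltW].
have main : Sx <= (M + 1) / (p * t) * Sy + expR (- M) * expR (expR 1 * t).
  apply: (@egf_le_shift _ (fun k => kpow P k o x) (fun k => kpow P k o y)).
  - by move=> k; exact: kpow_normr.
  - exact: k01.
  - exact: ltW.
  - exact: K0.
  - exact: expR_ge0.
  - by rewrite mulr_ge0 ?expR_ge0// ltW.
  move=> k; have fk : (0 : R) < k`!%:R by rewrite ltr0n fact_gt0.
  have tk : 0 <= t ^+ k by rewrite exprn_ge0// ltW.
  have [kM|Mk] := leP k%:R M.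
    have step := kpowD_ge stochP k 1 o y x.
    rewrite kpow1 addn1 -/p in step.
    apply: (@le_trans _ _ ((M + 1) / (p * t) *
        (kpow P k o x * p * t ^+ k.+1 / (k.+1)`!%:R))); last first.
      rewrite -[leLHS]addr0 lerD//.
        rewrite ler_wpM2l// ler_wpM2r ?invr_ge0//.
        by rewrite ler_wpM2r// exprn_ge0// ltW.
      by rewrite mulr_ge0 ?expR_ge0// divr_ge0 ?exprn_ge0 ?mulr_ge0 ?expR_ge0 ?(ltW t0)// ltW.
    have k1 : (0 : R) < k.+1%:R by rewrite ltr0n.
    have -> : (M + 1) / (p * t) * (kpow P k o x * p * t ^+ k.+1 / (k.+1)`!%:R) =
        (M + 1) / k.+1%:R * (kpow P k o x * t ^+ k / k`!%:R).
      rewrite factS natrM exprS; field.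
      by rewrite !gt_eqF.
    rewrite ler_peMl ?mulr_ge0 ?kpow_ge0 ?invr_ge0//.
    by rewrite ler_pdivlMr// mul1r -natr1 lerD2r.
  rewrite -[leLHS]add0r lerD//.
    rewrite mulr_ge0// divr_ge0//.
    by rewrite mulr_ge0 ?kpow_ge0// exprn_ge0// ltW.
  (* For [k > M], [kpow] is at most [1 <= expR (k - M)], and [expR k * t ^ k] is the [k]-th power of
     [expR 1 * t]. *)
  rewrite mulrA ler_wpM2r ?invr_ge0// exprMn mulrA ler_wpM2r//.
  rewrite -expRM_natl mulr1 -expRD; apply: le_trans (kpow_le1 stochP k o x) _.
  by rewrite -[leLHS]expR0 ler_expR addrC subr_ge0 ltW.
have half : expR (- M) * expR (expR 1 * t) <= Sx / 2.
  rewrite -expRD /M opprD addrAC addNr add0r opprD expRD expRN lnK ?posrE//.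
  rewrite mulrC ler_wpM2r ?invr_ge0// expRN expRM_natl lnK ?posrE ?divr_gt0 ?sparsity_gt0//.
  rewrite -exprVn invf_div.
  apply: le_trans (kpow_term_ge (ltW a0) (dt x)) _.
  exact: (egf_term_le (c := fun k => kpow P k o x) d (k01 x) (ltW t0)).
(* The crude [ln u <= u] costs one factor [Delta]; the other factor in the conclusion comes from
   [p^-1 <= Delta]. Only the logarithm of the result matters later. *)
have Mt : M + 1 <= t * ((expR 1 + 2 / a + a^-1 ^+ 2) * Delta).
  have ta : 1 <= t / a by rewrite ler_pdivlMr// mul1r.
  have d_le : d%:R <= t / a by rewrite ler_pdivlMr// mulrC dt.
  have l1 : ln (Delta / a) <= Delta / a.
    by apply/ltW/ln_sublinear; rewrite divr_gt0// sparsity_gt0.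
  have l2 : ln 2 <= 1 :> R by have := @le_ln1Dx R 1; rewrite -[1 + 1]/(2); apply; lra.
  have : d%:R * ln (Delta / a) <= t / a * (Delta / a) by rewrite ler_pM.
  have E0 : 0 <= (expR 1 + 2 / a) * t * (Delta - 1).
    apply: mulr_ge0; last by rewrite subr_ge0; lra.
    apply: mulr_ge0; last exact: ltW.
    by rewrite addr_ge0 ?expR_ge0// divr_ge0// ltW.
  rewrite /M; move: E0 ta; set i := a^-1; set D := Delta; lra.
have p_le : p^-1 <= Delta by exact: inv_le_sparsity.
have : Sx <= 2 * ((M + 1) / (p * t)) * Sy by lra.
move/le_trans; apply; rewrite ler_wpM2r//.
have -> : (M + 1) / (p * t) = p^-1 * ((M + 1) / t) by rewrite invfM; ring.
have Mt' : (M + 1) / t <= (expR 1 + 2 / a + a^-1 ^+ 2) * Delta.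
  by rewrite ler_pdivrMr// mulrC.
have : p^-1 * ((M + 1) / t) <= Delta * ((expR 1 + 2 / a + a^-1 ^+ 2) * Delta).
  rewrite ler_pM// ?invr_ge0 ?(ltW Pxy)//.
  by rewrite divr_ge0 ?(ltW t0)// addr_ge0.
rewrite /harnack_const; set X := expR 1 + _ + _; lra.
Qed.

(** Invariance gives [pi x >= pi y * P y x], and symmetric support makes the reverse edge
    available. *)
Lemma invariant_edge_le x y : 0 < P x y -> pi y <= Delta * pi x.
Proof.
move=> Pxy; have [<-|xy] := eqVneq x y.
  by rewrite ler_peMl ?(invariant_ge0 invpi)//; apply: le_trans sparsity_ge2; rewrite ler1n.
rewrite -ler_pdivrMl ?sparsity_gt0//.
have /symP Pyx := Pxy; have yx : y != x by rewrite eq_sym.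
apply: (@le_trans _ _ (pi y * P y x)).
  by rewrite mulrC ler_wpM2l ?(invariant_ge0 invpi)// sparsity_inv_le.
have [_ inv] := invpi; rewrite [leRHS]inv [leRHS](bigD1 y)//= lerDl sumr_ge0// => z _.
by rewrite mulr_ge0 ?(invariant_ge0 invpi)// transition_ge0.
Qed.

(** Harnack for the kernel and [invariant_edge_le] for [pi] give a density ratio of at most
    [C * Delta ^ 3] across an edge, with [C] the Harnack constant. As [ln Delta >= 1/2], its
    logarithm is at most [(3 + 2 * ln C) * ln Delta]. *)
Definition log_lip_const (a : R) : R := 3 + 2 * ln (harnack_const a).

Lemma ln2_ge_half : 2^-1 <= ln 2 :> R.
Proof.
rewrite -ler_expR lnK ?posrE// -[2^-1]opprK expRN -[leRHS]invrK lef_pV2 ?posrE ?expR_gt0//.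
by have := expR_ge1Dx (- 2^-1 : R); lra.
Qed.

Lemma ln_sparsity_ge_half : 2^-1 <= ln Delta.
Proof.
by apply: le_trans ln2_ge_half _; rewrite ler_ln ?posrE ?sparsity_gt0 ?sparsity_ge2.
Qed.

Lemma log_density_lipschitz (a t : R) o : 0 < a -> a <= 1 ->
  (forall z, a * (dist P o z)%:R <= t) -> a <= t ->
  edge_lipschitz P (log_lip_const a * ln Delta)
    (fun x => ln (heat_kernel P t o x / pi x)).
Proof.
move=> a0 a1 dt at_.
have t0 : 0 < t by exact: lt_le_trans at_.
have C1 := harnack_const_ge1 a0.
have C0 : 0 < harnack_const a := lt_le_trans ltr01 C1.
have D0 := sparsity_gt0; have l1 := ln_sparsity_ge_half.
have f0 x : 0 < heat_kernel P t o x / pi x.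
  by rewrite divr_gt0 ?heat_kernel_gt0 ?(invariant_gt0 stochP irrP invpi).
have CD0 : 0 < harnack_const a * Delta ^+ 3 by rewrite mulr_gt0// exprn_gt0.
have side x y : 0 < P x y -> ln (heat_kernel P t o x / pi x) <=
    ln (heat_kernel P t o y / pi y) + log_lip_const a * ln Delta.
  move=> Pxy; apply: (@le_trans _ _ (ln (heat_kernel P t o y / pi y *
      (harnack_const a * Delta ^+ 3)))).
    rewrite ler_ln ?posrE//; last exact: mulr_gt0.
    rewrite ler_pdivrMr ?(invariant_gt0 stochP irrP invpi)//.
    apply: le_trans (heat_kernel_harnack a0 a1 dt at_ Pxy) _.
    rewrite mulrC.
    have -> : heat_kernel P t o y / pi y * (harnack_const a * Delta ^+ 3) * pi x =
      heat_kernel P t o y * (harnack_const a * Delta ^+ 2) * (Delta * pi x / pi y) by ring.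
    rewrite ler_peMr//.
      apply: mulr_ge0; first exact: heat_kernel_ge0 (ltW t0).
      by apply: mulr_ge0; [exact: ltW | exact/exprn_ge0/ltW].
    by rewrite ler_pdivlMr ?mul1r ?(invariant_gt0 stochP irrP invpi)// invariant_edge_le.
  rewrite [X in X <= _]lnM ?posrE// lerD2l lnM ?posrE ?exprn_gt0//.
  rewrite lnXn// /log_lip_const -mulr_natl.
  have := ln_ge0 C1; nra.
move=> x y Pxy; have /symP Pyx := Pxy.
by have := side _ _ Pxy; have := side _ _ Pyx; rewrite ler_norml; lra.
Qed.

(** * Speed of the chain and lower bound on mixing times *)

(** Jumps occur at rate one and each moves the distance by at most 1. *)
Lemma heat_op_dist_le t o : 0 <= t ->
  heat_op P t (fun y => (dist P o y)%:R) o <= t.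
Proof.
move=> t0; have := @heat_flow_le R T P stochP (fun _ y => (dist P o y)%:R)
  (fun _ _ => 0) 1 t o t0.
rewrite dist_refl add0r mul1r; apply => s y _.
rewrite addr0 /generator -[leRHS](transition_sum stochP y); apply: ler_sum => z _.
have := transition_ge0 stochP y z; rewrite le_eqVlt => /orP[/eqP <-|Pyz].
  by rewrite mul0r.
rewrite ler_piMr ?(ltW Pyz)//.
by have := dist_edge_lipschitz o Pyz; rewrite ler_norml; lra.
Qed.

(** Seen from a suitable [z], Chebyshev gives the ball of radius [D / 4] a [pi]-mass of at most
    [8 * trel / D ^ 2 <= e / 2], so the chain leaves it with probability at least [e / 2]. Its mean
    distance, at most [t], is then at least [e / 2 * (D / 4)]. *)
Lemma tmix_diam_lower t (e : R) (D : nat) : 0 <= t -> 0 < e -> e <= 1 ->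
  (exists x y, dist P x y = D) ->
  (forall x, tv_dist (heat_kernel P t x) pi <= 1 - e) ->
  16 * trel P pi / e <= D%:R ^+ 2 ->
  e / 8 * D%:R <= t.
Proof.
move=> t0 e0 e1 [x [y dxy]] tv bigD.
have card1 : (1 < #|T|)%N by rewrite (leq_trans _ cardT).
have tau0 : 0 < trel P pi by exact: trel_gt0.
pose m z := mean_under pi (fun w => (dist P z w)%:R).
have [z mz] : exists z, D%:R / 2 <= m z.
  have : D%:R <= m x + m y.
    rewrite /m /mean_under -big_split /= -(mean_cst invpi D%:R).
    apply: ler_sum => w _; rewrite -mulrDr ler_wpM2l ?(invariant_ge0 invpi)//.
    by rewrite -natrD ler_nat -dxy [dist P y w]dist_sym dist_triangle.
  have [|mx] := leP (D%:R / 2) (m x); first by exists x.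
  by move=> mxy; exists y; lra.
pose g w : R := (dist P z w)%:R.
have D20 : 0 < D%:R ^+ 2 :> R.
  by apply: lt_le_trans bigD; rewrite divr_gt0// mulr_gt0.
have D0 : 0 <= D%:R :> R by [].
have varg : var_under pi g <= trel P pi / 2.
  apply: le_trans (trel_poincare stochP irrP invpi card1 g) _.
  rewrite ler_wpM2l ?(ltW tau0)// -[leRHS](mean_cst invpi).
  apply: (mean_le invpi) => w.
  have := carre_du_champ_lipschitz stochP w (dist_edge_lipschitz z).
  by rewrite expr1n mul1r.
pose A : {set T} := [set w | D%:R / 4 < g w]%SET.
have piAc : \sum_(w | w \notin A) pi w <= e / 2.
  have : (\sum_(w | w \notin A) pi w) * (D%:R / 4) ^+ 2 <= trel P pi / 2.
    apply: le_trans varg; rewrite mulr_suml [leRHS](bigID (fun w => w \notin A)) /=.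
    rewrite -[leLHS]addr0 lerD//; last first.
      by apply: sumr_ge0 => w _; rewrite mulr_ge0 ?sqr_ge0 ?(invariant_ge0 invpi).
    apply: ler_sum => w; rewrite !inE -leNgt => gw.
    rewrite ler_wpM2l ?(invariant_ge0 invpi)//.
    by rewrite -/g; move: mz gw; rewrite /m -/g; set mm := mean_under _ _; nra.
  rewrite ler_pdivrMr// in bigD; rewrite exprMn => H.
  rewrite -(ler_pM2r D20); nra.
have e10 : 0 <= 1 - e by rewrite subr_ge0.
have HA : e / 2 <= \sum_(w in A) heat_kernel P t z w.
  have /(tv_distP _ _ e10)/(_ A) := tv z.
  have := invariant_sum invpi; rewrite (bigID (mem A)) /=.
  by rewrite ler_norml; lra.
apply: le_trans (heat_op_dist_le z t0).
apply: (@le_trans _ _ (\sum_(w in A) heat_kernel P t z w * (D%:R / 4))).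
  by rewrite -mulr_suml; nra.
rewrite /heat_op [leRHS](bigID (mem A)) /= -[leLHS]addr0 lerD//.
  apply: ler_sum => w; rewrite inE => /ltW gw.
  by apply: ler_wpM2l gw; exact: heat_kernel_ge0.
by apply: sumr_ge0 => w _; apply: mulr_ge0 => //; exact: heat_kernel_ge0.
Qed.

End Sparse.

(** * The cutoff window *)

Section Cutoff.
Variables (R : realType) (T : finType) (P : T -> T -> R) (pi : T -> R).
Hypothesis stochP : stochastic P.
Hypothesis irrP : irreducible P.
Hypothesis invpi : invariant_law P pi.
Hypothesis symP : symmetric_support P.
Hypothesis cardT : (3 <= #|T|)%N.
Hypothesis curvP : nonneg_curvature P.
Implicit Types (x y : T) (t e : R).

Let card_gt1 : (1 < #|T|)%N. Proof. exact: leq_trans cardT. Qed.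

Lemma worst_tv_leP t e : 0 <= e ->
  \big[Num.max/0]_x tv_dist (heat_kernel P t x) pi <= e <->
  forall x, tv_dist (heat_kernel P t x) pi <= e.
Proof.
move=> e0; split=> [le_e x|le_e]; last by apply: bigmax_le.
apply: le_trans le_e.
exact: (le_bigmax _ (fun x => tv_dist (heat_kernel P t x) pi)).
Qed.

(** Makes the infimum in [tmix] range over a nonempty set. The density of a point mass is at most
    [expR M], so [mixing_of_density_tail] applies from time 0 with an empty tail. *)
Lemma mixed_time_exists e : 0 < e ->
  exists t, 0 <= t /\ forall x, tv_dist (heat_kernel P t x) pi <= e.
Proof.
move=> e0; have tau0 := trel_gt0 stochP irrP invpi card_gt1.
pose M := ln (\sum_x (pi x)^-1).
have ip x : 0 < (pi x)^-1 by rewrite invr_gt0 (invariant_gt0 stochP irrP invpi).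
pose b := `|M| + `|ln (e ^+ 2 / 4)|; have b0 : 0 <= b by rewrite addr_ge0.
have t0 : 0 <= trel P pi * b / 2 by rewrite divr_ge0// mulr_ge0// ltW.
exists (trel P pi * b / 2); split=> // x.
have pv : probability_vector (heat_kernel P 0 x).
  by split=> [y|]; [exact: heat_kernel_ge0 | exact: heat_kernel_sum].
have := mixing_of_density_tail stochP irrP invpi card_gt1 (M := M) pv e0 t0.
rewrite (_ : (fun y => \sum_z _) = heat_kernel P (trel P pi * b / 2) x); last first.
  apply/funext => y; under eq_bigr do rewrite heat_kernel0.
  exact: (sum_indicator (fun z => heat_kernel P _ z y)).
apply.
  rewrite big_pred0 ?divr_ge0 ?(ltW e0)// => y; apply/negbTE; rewrite -leNgt.
  have S0 : (pi y)^-1 <= \sum_z (pi z)^-1.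
    by rewrite (bigD1 y)//= lerDl sumr_ge0// => z _; exact: ltW.
  rewrite lnK ?posrE ?(lt_le_trans (ip y))//.
  apply: le_trans (heat_kernel_le1 stochP x y (lexx 0)) _.
  by rewrite -ler_pdivrMr ?(invariant_gt0 stochP irrP invpi)// div1r.
rewrite -[_ / 4]lnK ?posrE ?divr_gt0 ?exprn_gt0// ler_expR.
have -> : 2 * (trel P pi * b / 2) / trel P pi = b by field; rewrite gt_eqF.
have := ler_norm M; have := ler_norm (- ln (e ^+ 2 / 4)); rewrite normrN /b; lra.
Qed.

Lemma tmix_le t e : 0 <= e -> 0 <= t ->
  (forall x, tv_dist (heat_kernel P t x) pi <= e) -> tmix P pi e <= t.
Proof.
move=> e0 t0 te; apply: ge_inf; first by exists 0 => s [].
by split=> //; apply/worst_tv_leP.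
Qed.

Lemma le_tmix b e : 0 < e ->
  (forall t, 0 <= t -> (forall x, tv_dist (heat_kernel P t x) pi <= e) -> b <= t) ->
  b <= tmix P pi e.
Proof.
move=> e0 le_b; apply: lb_le_inf.
  have [t [t0 te]] := mixed_time_exists e0.
  by exists t; split=> //; apply/worst_tv_leP => //; exact: ltW.
move=> t [t0 /(worst_tv_leP t (ltW e0))]; exact: le_b.
Qed.

Lemma tmix_anti e e' : 0 < e -> e <= e' -> tmix P pi e' <= tmix P pi e.
Proof.
move=> e0 ee'; apply: le_tmix => // t t0 te.
apply: tmix_le => // [|x]; last exact: le_trans (te x) ee'.
exact: le_trans (ltW e0) ee'.
Qed.

Lemma diameter_exists : exists2 D : nat,
  forall x y, (dist P x y <= D)%N & exists x y, dist P x y = D.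
Proof.
have /card_gt0P[ o _] : (0 < #|T|)%N by exact: leq_trans cardT.
have [[x y] /= _ ub] := @arg_maxnP _ (o, o) xpredT (fun p => dist P p.1 p.2) isT.
by exists (dist P x y) => [u v|]; [exact: (ub (u, v)) | exists x, y].
Qed.

(** One summand per requirement of [cutoff_step]: a diameter large enough for [tmix_diam_lower], a
    small variance of the log-density, a negligible [trel * ln (2 / e)]. The factors [8 / e] convert
    diameter into time. *)
Definition window_const (e eta : R) : R :=
  128 / e + 8 / e * (16 * log_lip_const (e / 8) ^+ 2 / (e * eta ^+ 2))
  + 8 / e * (32 * ln (2 / e) / eta).

Local Notation tau := (trel P pi).
Local Notation ell := (ln (sparsity P)).

(** The volume bound reads [ln N <= D * (1 + ell)], and [1 + ell <= 3 * ell] because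
    [ell >= 1/2]. *)
Lemma diameter_ge (D : nat) (X : R) : 0 <= X ->
  (forall x y, (dist P x y <= D)%N) ->
  3 * X * (tau ^+ 2 * ell ^+ 3) <= ln #|T|%:R ->
  X * (tau ^+ 2 * ell ^+ 2) <= D%:R.
Proof.
move=> X0 leD hyp; have l1 := ln_sparsity_ge_half stochP irrP symP cardT.
have : ln #|T|%:R <= D%:R * (1 + ell).
  rewrite -[leRHS]expRK ler_ln ?posrE ?expR_gt0 ?ltr0n ?(leq_trans _ cardT)//.
  exact: card_le_diam.
have l0 : 0 < ell by lra.
have D0 : 0 <= D%:R :> R by [].
move=> H; rewrite -(ler_pM2r l0) -(ler_pM2l (x := 3))//.
have -> : 3 * (X * (tau ^+ 2 * ell ^+ 2) * ell) = 3 * X * (tau ^+ 2 * ell ^+ 3) by ring.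
apply: (le_trans hyp); apply: (le_trans H); nra.
Qed.

(** Take [r = eta * t / (2 * tau)]: half of the extra time [eta * t] pays for [tau * r], the other
    half for [2 * tau * ln (2 / e)]. The variance condition becomes [16 * K ^ 2 * tau ^ 2 * ell ^ 2
    <= e * eta ^ 2 * t], which the diameter bound on [t] provides. *)
Lemma cutoff_step (e eta t : R) : 0 < e -> e < 1 -> 0 < eta ->
  3 * window_const e eta * (tau ^+ 2 * ell ^+ 3) <= ln #|T|%:R ->
  0 <= t -> (forall x, tv_dist (heat_kernel P t x) pi <= 1 - e) ->
  e / 8 <= t /\ forall x, tv_dist (heat_kernel P (t + eta * t) x) pi <= e.
Proof.
move=> e0 e1 eta0 hyp t0 tv.
have tau2 := trel_ge_half stochP irrP invpi card_gt1.
have l1 := ln_sparsity_ge_half stochP irrP symP cardT.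
have [D leD atD] := diameter_exists.
pose a := e / 8; pose K := log_lip_const a; pose lam := ln (2 / e).
have a0 : 0 < a by rewrite divr_gt0.
have a1 : a <= 1 by rewrite /a; lra.
have lam0 : 0 <= lam by rewrite ln_ge0// ler_pdivlMr// mul1r; lra.
have K0 : 0 < K.
  by have := ln_ge0 (harnack_const_ge1 a0); rewrite /K /log_lip_const; lra.
pose w1 := 128 / e; pose w2 := 16 * K ^+ 2 / (e * eta ^+ 2).
pose w3 := 32 * lam / eta.
have w10 : 0 <= w1 by rewrite divr_ge0// ltW.
have w20 : 0 <= w2.
  by rewrite divr_ge0 ?mulr_ge0 ?exprn_ge0 ?(ltW e0) ?(ltW eta0) ?(ltW K0).
have w30 : 0 <= w3 by rewrite divr_ge0 ?mulr_ge0 ?(ltW eta0).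
have ia0 : 0 <= a^-1 by rewrite invr_ge0 ltW.
have XE : window_const e eta = w1 + a^-1 * w2 + a^-1 * w3.
  by rewrite /window_const /a invf_div.
have X0 : 0 <= window_const e eta by rewrite XE !addr_ge0// mulr_ge0.
pose q := tau ^+ 2 * ell ^+ 2.
(* Both [tau] and [ell] are at least 1/2. *)
have q_ge : tau / 8 <= q.
  rewrite /q expr2 -mulrA ler_wpM2l; nra.
have q0 : 0 <= q by apply: le_trans q_ge; lra.
have DX : window_const e eta * q <= D%:R := diameter_ge X0 leD hyp.
have Dpos : (0 < D)%N.
  have /card_gt1P[x [y [_ _ xy]]] := card_gt1.
  exact: leq_trans (dist_gt0 irrP xy) (leD x y).
have D1 : 1 <= D%:R :> R by rewrite ler1n.
have D_ge (w : R) : w <= window_const e eta -> w * q <= D%:R.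
  by move=> wX; apply: le_trans DX; rewrite ler_wpM2r.
have w1X : w1 <= window_const e eta by rewrite XE -addrA lerDl addr_ge0// mulr_ge0.
have w2X : a^-1 * w2 <= window_const e eta.
  by rewrite XE addrAC lerDr addr_ge0// mulr_ge0.
have w3X : a^-1 * w3 <= window_const e eta by rewrite XE lerDr addr_ge0// mulr_ge0.
have bigD : 16 * tau / e <= D%:R ^+ 2.
  apply: (@le_trans _ _ D%:R); last by rewrite expr2 ler_peMl.
  apply: le_trans (D_ge _ w1X).
  by rewrite (_ : 16 * tau / e = w1 * (tau / 8)) ?ler_wpM2l// /w1; field; rewrite gt_eqF.
have aDt : a * D%:R <= t.
  by apply: tmix_diam_lower tv bigD => //; exact: ltW.
have at_ : a <= t by apply: le_trans aDt; rewrite ler_peMr// ltW.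
have t1 : 0 < t by exact: lt_le_trans at_.
split=> // x.
have t_ge (w : R) : a^-1 * w <= window_const e eta -> w * q <= t.
  move=> /D_ge; rewrite -mulrA ler_pdivrMl// => H; exact: le_trans H aDt.
have t2 := t_ge _ w2X; have t3 := t_ge _ w3X.
have dt o z : a * (dist P o z)%:R <= t.
  by apply: le_trans aDt; rewrite ler_wpM2l ?(ltW a0)// ler_nat.
have tau0 : 0 < tau by lra.
have L0 : 0 < K * ell by rewrite mulr_gt0//; lra.
have lip := log_density_lipschitz stochP irrP invpi symP cardT a0 a1 (dt x) at_.
have var := nonneg_curvature_variance stochP x irrP curvP t0 L0 lip.
apply: (mixing_of_variance stochP irrP invpi card_gt1 (r := eta / 2 * t / tau)) (tv x) _ => //.
- exact: ltW.
- by rewrite divr_gt0// mulr_gt0// divr_gt0.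
- by move=> y; exact: heat_kernel_gt0.
- apply: (le_trans var).
  have -> : e / 4 * (eta / 2 * t / tau) ^+ 2 =
      t * (e * eta ^+ 2 * t / (16 * tau ^+ 2)) by field; rewrite gt_eqF.
  rewrite ler_wpM2l// ler_pdivlMr ?mulr_gt0 ?exprn_gt0//.
  have : w2 * q * (e * eta ^+ 2) <= t * (e * eta ^+ 2).
    by rewrite ler_wpM2r// mulr_ge0 ?exprn_ge0// ltW.
  have -> : w2 * q * (e * eta ^+ 2) = 16 * K ^+ 2 * q.
    by rewrite /w2; field; rewrite !gt_eqF.
  by rewrite /q; lra.
- have -> : tau * (eta / 2 * t / tau + 2 * ln (2 / e)) = eta * t / 2 + 2 * (tau * lam).
    by rewrite /lam; field; rewrite gt_eqF.
  have : w3 * q * eta <= t * eta by rewrite ler_wpM2r// ltW.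
  have -> : w3 * q * eta = 32 * (lam * q) by rewrite /w3; field; rewrite gt_eqF.
  have : lam * (tau / 8) <= lam * q by rewrite ler_wpM2l.
  lra.
Qed.

Lemma cutoff_window (e eta : R) : 0 < e -> e < 1 -> 0 < eta ->
  3 * window_const e eta * (tau ^+ 2 * ell ^+ 3) <= ln #|T|%:R ->
  0 < tmix P pi (1 - e) /\ tmix P pi e <= (1 + eta) * tmix P pi (1 - e).
Proof.
move=> e0 e1 eta0 hyp.
have step t := @cutoff_step e eta t e0 e1 eta0 hyp.
have e1' : 0 < 1 - e by rewrite subr_gt0.
split.
  apply: (@lt_le_trans _ _ (e / 8)); first by rewrite divr_gt0.
  by apply: le_tmix => // t t0 te; have [] := step t t0 te.
have eta1 : 0 < 1 + eta by rewrite addr_gt0.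
rewrite -ler_pdivrMl//; apply: le_tmix => // t t0 te.
have [_ te'] := step t t0 te.
rewrite ler_pdivrMl// mulrDl mul1r; apply: tmix_le => //; first exact: ltW.
by rewrite addr_ge0// mulr_ge0// ltW.
Qed.

End Cutoff.

Theorem corollary2 (R : realType) (X : nat -> finType)
    (P : forall n, X n -> X n -> R) (pi : forall n, X n -> R)
    (cardX : forall n, (3 <= #|X n|)%N)
    (stochP : forall n, stochastic (P n))
    (irrP : forall n, irreducible (P n))
    (invpi : forall n, invariant_law (P n) (pi n))
    (symP : forall n, symmetric_support (P n))
    (curvP : forall n, nonneg_curvature (P n))
    (sparse : (fun n : nat => trel (P n) (pi n) *
        (ln (sparsity (P n)) `^ (3 / 2) / ln (#|X n|%:R : R) `^ (1 / 2)))
        @ \oo --> (0 : R)) :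
  forall eps : R, 0 < eps < 1 ->
    (fun n : nat => tmix (P n) (pi n) (1 - eps) / tmix (P n) (pi n) eps)
      @ \oo --> (1 : R).
Proof.
move=> eps /andP[eps0 eps1].
(* Both mixing times in the ratio then lie between [tmix (1 - e)] and [tmix e], whichever side of
   1/2 [eps] is on. *)
pose e := Num.min eps (1 - eps).
have e0 : 0 < e by rewrite lt_min eps0 subr_gt0.
have [e_le e_le'] : e <= eps /\ e <= 1 - eps by rewrite !ge_min !lexx orbT.
have e1 : e < 1 by exact: le_lt_trans eps1.
apply/cvgrPdist_le => eta eta0.
(* A positive majorant of the window constant. Squaring the hypothesis at threshold
   [sqrt (1 / (3 * C))] gives [3 * C * tau ^ 2 * ell ^ 3 <= ln N]. *)
pose C := `|window_const e eta| + 1.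
have C0 : 0 < C by rewrite ltr_wpDl.
have d0 : 0 < Num.sqrt (3 * C)^-1 by rewrite sqrtr_gt0 invr_gt0 mulr_gt0.
move/cvgrPdist_le : sparse => /(_ _ d0) near_sparse.
near=> n.
have small : `|0 - trel (P n) (pi n) *
   (ln (sparsity (P n)) `^ (3 / 2) / ln (#|X n|%:R : R) `^ (1 / 2))| <=
   Num.sqrt (3 * C)^-1 by near: n.
have tau0 : 0 < trel (P n) (pi n).
  by apply: trel_gt0 => //; exact: ltn_trans (cardX n).
have ell0 : 0 < ln (sparsity (P n)).
  by apply: lt_le_trans (ln_sparsity_ge_half _ _ _ _); rewrite ?invr_gt0.
have N0 : 0 < ln (#|X n|%:R : R) by rewrite ln_gt0// ltr1n; exact: ltn_trans (cardX n).
have hyp : 3 * window_const e eta *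
    (trel (P n) (pi n) ^+ 2 * ln (sparsity (P n)) ^+ 3) <= ln #|X n|%:R.
  apply: (@le_trans _ _ (3 * C *
      (trel (P n) (pi n) ^+ 2 * ln (sparsity (P n)) ^+ 3))).
    rewrite ler_wpM2r ?mulr_ge0 ?exprn_ge0 ?(ltW tau0) ?(ltW ell0)// ler_wpM2l//.
    by rewrite (le_trans (ler_norm _))// lerDl.
  have sqr_powR (x y : R) : 0 <= x -> (x `^ (y / 2)) ^+ 2 = x `^ y.
    by move=> x0; rewrite -powR_mulrn ?powR_ge0// -powRrM divfK.
  move: small; rewrite sub0r normrN => small.
  have : (trel (P n) (pi n) * (ln (sparsity (P n)) `^ (3 / 2) /
     ln (#|X n|%:R : R) `^ (1 / 2))) ^+ 2 <= (3 * C)^-1.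
    rewrite -[leRHS]sqr_sqrtr ?invr_ge0 ?mulr_ge0 ?(ltW C0)//.
    by rewrite -(real_normK (num_real _)) lerXn2r ?nnegrE ?sqrtr_ge0.
  rewrite !exprMn exprVn !sqr_powR ?(ltW ell0) ?(ltW N0)//.
  rewrite powRr1 ?(ltW N0)// powR_mulrn ?(ltW ell0)// mulrA ler_pdivrMr//.
  by rewrite -ler_pdivrMl ?invr_gt0 ?mulr_gt0// invrK.
have [tm0 tm] := cutoff_window (stochP n) (irrP n) (invpi n) (symP n) (cardX n)
  (curvP n) e0 e1 eta0 hyp.
have anti := tmix_anti (stochP n) (irrP n) (invpi n) (cardX n).
have a1 : tmix (P n) (pi n) (1 - e) <= tmix (P n) (pi n) eps.
  by apply: anti => //; rewrite lerBrDl -lerBrDr.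
have a2 : tmix (P n) (pi n) (1 - e) <= tmix (P n) (pi n) (1 - eps).
  by apply: anti; [rewrite subr_gt0 | rewrite lerD2l lerN2].
have b1 : tmix (P n) (pi n) eps <= tmix (P n) (pi n) e by exact: anti.
have b2 : tmix (P n) (pi n) (1 - eps) <= tmix (P n) (pi n) e by exact: anti.
have t0 : 0 < tmix (P n) (pi n) eps by exact: lt_le_trans a1.
rewrite -[X in X - _](divff (lt0r_neq0 t0)) -mulrBl normrM normfV (gtr0_norm t0).
rewrite ler_pdivrMr// ler_norml; apply/andP.
have : eta * tmix (P n) (pi n) (1 - e) <= eta * tmix (P n) (pi n) eps.
  by rewrite ler_wpM2l// ltW.
by split; lra.
Unshelve. all: by end_near. Qed.
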